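(* Let $\Sigma$ be a finite alphabet, $\mathcal{F}\subseteq\Sigma^*$ a finite reduced set of words, $P\in[0,1]^{\mathcal{F}}$, and let $\overline{X}(\mathcal{F},P)$ be the weak semiconstrained system with tolerance function $\xi$. Set $k=\max_{\phi\in\mathcal{F}}|\phi|$ and $$\Delta=\{\nu\in[0,1]^{\mathcal{F}} : \forall\phi\in\mathcal{F},\ \nu(\phi)\leq P(\phi)\}.$$ Let $M_\sigma(\Sigma^k)$ be the set of shift-invariant probability measures on $\Sigma^k$ and let $f:M_\sigma(\Sigma^k)\to[0,1]^{\mathcal{F}}$ be the linear map $$f(\nu)(\phi)=\sum_{\omega\in\Sigma^k,\ \omega_0\cdots\omega_{|\phi|-1}=\phi}\nu(\omega),\qquad \phi\in\mathcal{F}.$$ Suppose that $f^{-1}(\Delta)\neq\emptyset$ and that $\xi(n)\geq 2|\Sigma|^{k-1}n^{-1}$ for all $n$. Then the limit below exists and $$\overline{\mathsf{cap}}(\mathcal{F},P)=\lim_{n\to\infty}\frac1n\log_2\left|\overline{\mathcal{B}}_n(\mathcal{F},P)\right|=\log_2|\Sigma|-\inf_{\mu\in f^{-1}(\Delta)}I(\mu).$$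
   Context: A set $\mathcal{F}$ of words is reduced if no proper (contiguous) subword of a word of $\mathcal{F}$ is in $\mathcal{F}$. For words $\tau,\omega$ with $|\tau|\leq|\omega|$, $T(\tau,\omega)=\frac{1}{|\omega|-|\tau|+1}\#\{0\leq i\leq|\omega|-|\tau| : \omega_i\cdots\omega_{i+|\tau|-1}=\tau\}$; if $|\tau|>|\omega|$, $T(\tau,\omega)=0$. The weak semiconstrained system with tolerance $\xi$ is $\overline{X}(\mathcal{F},P)=\{\omega\in\Sigma^* : \forall\phi\in\mathcal{F},\ T(\phi,\omega)\leq P(\phi)+\xi(|\omega|)\}$, where $\xi:\mathbb{N}\to\mathbb{R}^+$ satisfies $\xi(n)=o(1)$ and $\xi(n)=\Omega(1/n)$. $\overline{\mathcal{B}}_n(\mathcal{F},P)=\overline{X}(\mathcal{F},P)\cap\Sigma^n$ and $\overline{\mathsf{cap}}(\mathcal{F},P)=\limsup_{n\to\infty}\frac1n\log_2|\overline{\mathcal{B}}_n(\mathcal{F},P)|$. A probability measure $\nu$ on $\Sigma^k$ is shift invariant if $\sum_{\sigma\in\Sigma}\nu(\sigma,\sigma_1,\dots,\sigma_{k-1})=\sum_{\sigma\in\Sigma}\nu(\sigma_1,\dots,\sigma_{k-1},\sigma)$ for all $(\sigma_1,\dots,\sigma_{k-1})\in\Sigma^{k-1}$. For such $\nu$, with $\nu_1(\sigma_0,\dots,\sigma_{k-2})=\sum_{\sigma\in\Sigma}\nu(\sigma_0,\dots,\sigma_{k-2},\sigma)$, $$I(\nu)=\sum_{\sigma\in\Sigma^k}\nu(\sigma)\log_2\frac{\nu(\sigma)}{\nu_1(\sigma_0,\dots,\sigma_{k-2})\,q(\sigma_{k-1})},$$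 where $q(a)=1/|\Sigma|$ for all $a\in\Sigma$ (uniform distribution), and $0\log_2 0=0$. *)

(* Defs.v *)
From mathcomp Require Import all_boot all_order all_algebra finmap.
From mathcomp Require Import all_classical all_reals all_analysis.
Set Implicit Arguments.
Unset Strict Implicit.
Unset Printing Implicit Defensive.
Import Order.TTheory GRing.Theory Num.Theory.
Import numFieldNormedType.Exports.
Local Open Scope classical_set_scope.
Local Open Scope ring_scope.

Definition reduced (Sigma : finType) (F : {fset seq Sigma}) : Prop :=
  forall phi psi : seq Sigma,
    phi \in F -> infix psi phi -> psi != phi -> psi \notin F.

Definition max_length (Sigma : finType) (F : {fset seq Sigma}) : nat :=
  (\max_(phi : F) size (val phi))%N.

Definition frequency (R : realType) (Sigma : finType) (tau w : seq Sigma) : R :=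
  if (size tau <= size w)%N then
    #|[set i : 'I_(size w - size tau).+1 |
        take (size tau) (drop i w) == tau]%SET|%:R
    / (size w - size tau).+1%:R
  else 0.

Definition tolerance (R : realType) (xi : nat -> R) : Prop :=
  [/\ forall n, 0 < xi n,
      xi =o_\oo (fun=> 1 : R)
    & xi \is 'Omega_\oo (fun n => n%:R^-1 : R)].

Definition weak_scs (R : realType) (Sigma : finType) (F : {fset seq Sigma})
    (P : F -> R) (xi : nat -> R) : pred (seq Sigma) :=
  [pred w | [forall phi : F,
     frequency R (val phi) w <= P phi + xi (size w)]].

Definition weak_block (R : realType) (Sigma : finType) (F : {fset seq Sigma})
    (P : F -> R) (xi : nat -> R) (n : nat) : {set n.-tuple Sigma} :=
  [set w : n.-tuple Sigma | tval w \in weak_scs P xi]%SET.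

Definition log2 (R : realType) (x : R) : R := ln x / ln 2.

(* Extended-real valued, so that [elog2 0 = -oo] (whereas [ln 0 = 0]): some of
   the sets counted below may be empty. *)
Definition elog2 (R : realType) (x : R) : \bar R :=
  (lne x%:E * ((ln 2 : R)^-1)%:E)%E.

Definition weak_rate (R : realType) (Sigma : finType) (F : {fset seq Sigma})
    (P : F -> R) (xi : nat -> R) (n : nat) : \bar R :=
  ((n%:R^-1 : R)%:E * elog2 (#|weak_block P xi n|%:R : R))%E.

Definition weak_cap (R : realType) (Sigma : finType) (F : {fset seq Sigma})
    (P : F -> R) (xi : nat -> R) : \bar R :=
  limn_esup (weak_rate P xi).

(* From here on the word length k >= 1 is written m.+1, and a measure on
   Sigma^k is given by its point masses. *)
Definition shift_invariant_measures (R : realType) (Sigma : finType) (m : nat) :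
    set (m.+1.-tuple Sigma -> R) :=
  [set nu | [/\ forall w, 0 <= nu w,
                \sum_w nu w = 1
              & forall s : m.-tuple Sigma,
                  \sum_(a : Sigma) nu [tuple of a :: s]
                  = \sum_(a : Sigma) nu [tuple of rcons s a]]].

Arguments shift_invariant_measures : clear implicits.

Definition first_marginal (R : realType) (Sigma : finType) (m : nat)
    (nu : m.+1.-tuple Sigma -> R) (s : m.-tuple Sigma) : R :=
  \sum_(a : Sigma) nu [tuple of rcons s a].

Definition uniform_mass (R : realType) (Sigma : finType) (a : Sigma) : R :=
  #|Sigma|%:R^-1.

(* The convention 0 log 0 = 0 holds since [log2] is real-valued. *)
Definition rate_function (R : realType) (Sigma : finType) (m : nat)
    (nu : m.+1.-tuple Sigma -> R) : R :=
  \sum_(w : m.+1.-tuple Sigma)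
    nu w * log2 (nu w / (first_marginal nu [tuple of belast (thead w) (behead w)]
                         * uniform_mass R (last (thead w) (behead w)))).

Definition admissible (R : realType) (Sigma : finType) (F : {fset seq Sigma})
    (P : F -> R) : set (F -> R) :=
  [set v | forall phi : F, 0 <= v phi <= 1 /\ v phi <= P phi].

Definition prefix_marginal (R : realType) (Sigma : finType)
    (F : {fset seq Sigma}) (m : nat) (nu : m.+1.-tuple Sigma -> R) : F -> R :=
  fun phi => \sum_(w : m.+1.-tuple Sigma | take (size (val phi)) w == val phi)
               nu w.

Definition admissible_measures (R : realType) (Sigma : finType)
    (F : {fset seq Sigma}) (P : F -> R) (m : nat) :
    set (m.+1.-tuple Sigma -> R) :=
  shift_invariant_measures R Sigma m
  `&` @prefix_marginal R Sigma F m @^-1` admissible P.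
Arguments admissible_measures {R Sigma F} P m.

(* Main.v *)
(* A word of length n is a walk on the de Bruijn graph whose vertices are the words
   of length k-1 and whose edges are the words of length k. The shift invariant
   measures on words of length k are the normalised circulations of this graph,
   and log |Sigma| - I(nu) is the conditional entropy of the last letter.

   Upper bound: wrapping a word around gives an integral circulation N of total
   n+k-1. There are polynomially many circulations, each carried by at most
   exp (entropy N) words, and by compactness the entropy of measures that violate
   the constraints by o(1) is at most sup entropy + o(1).

   Lower bound: for nu in f^-1(Delta), round n nu to an integral circulation with
   an error below 1 on each edge and add 1 on every edge. Words of length j <= k
   then occur at most 2 |Sigma|^(k-j) times too often, which the tolerance
   2 |Sigma|^(k-1) / n absorbs. The resulting circulation is connected, and its
   Eulerian circuits are at least as many as the orderings of the exits of each
   vertex in which the last exit is prescribed by a spanning tree. By Stirling's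
   formula this is exp (n entropy nu - O(log n)). *)
Require Import Defs.
From mathcomp Require Import all_boot all_order all_algebra finmap.
From mathcomp Require Import all_classical all_reals all_analysis.
From mathcomp Require Import zify ring lra.
Import Order.TTheory GRing.Theory Num.Theory.
Import numFieldNormedType.Exports.
Local Open Scope classical_set_scope.
Local Open Scope ring_scope.
Set Implicit Arguments.
Unset Strict Implicit.
Unset Printing Implicit Defensive.

(** * Rounding circulations *)

Lemma homogeneous_solution (K : fieldType) (X Y : finType) (c : X -> Y -> K) :
  (#|Y| < #|X|)%N ->
  exists z : X -> K,
    (exists x, z x != 0) /\ forall y, \sum_x z x * c x y = 0.
Proof.
move=> YX; pose A := \matrix_(i < #|X|, j < #|Y|) c (enum_val i) (enum_val j).
have : ~~ row_free A.
  by rewrite /row_free neq_ltn (leq_ltn_trans (rank_leq_col A) YX).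
rewrite -kermx_eq0 => /rowV0Pn [u /sub_kermxP uA u0].
exists (fun x => u 0 (enum_rank x)); split.
  case: (pselect (exists i, u 0 i != 0)) => [[i ui]|nu].
    by exists (enum_val i); rewrite enum_valK.
  exfalso; move/negP: u0; apply; apply/eqP/rowP => i; rewrite mxE.
  by apply/eqP; apply: contra_notT nu => ui; exists i.
move=> y; move/rowP/(_ (enum_rank y)): uA; rewrite !mxE => uAy.
rewrite -[RHS]uAy (reindex (@enum_rank X)) /=; last first.
  exact/onW_bij/enum_rank_bij.
by apply: eq_bigr => x _; rewrite mxE !enum_rankK.
Qed.

Section Digraph.
Variables (V E : finType) (src tgt : E -> V).

Definition balanced (R : nmodType) (x : E -> R) :=
  forall v, \sum_(e | tgt e == v) x e = \sum_(e | src e == v) x e.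

(* There are at least as many edges in [A] as vertices that they touch, and the
   balance equations at these vertices sum to zero, so one is redundant. *)
Lemma exists_circulation (R : fieldType) (A : pred E) :
  (exists e, A e) ->
  (forall v, (#|[pred e | A e && (src e == v)]|
              + #|[pred e | A e && (tgt e == v)]| != 1)%N) ->
  exists z : E -> R,
    [/\ exists e, z e != 0, forall e, ~~ A e -> z e = 0 & balanced z].
Proof.
case=> e0 Ae0 deg1.
pose deg v := (#|[pred e | A e && (src e == v)]|
  + #|[pred e | A e && (tgt e == v)]|)%N.
have sum_end (f : E -> V) :
    (\sum_v #|[pred e | A e && (f e == v)]| = #|A|)%N.
  rewrite -sum1_card (partition_big f xpredT)//=; apply: eq_bigr => v _.
  by rewrite sum1_card; apply: eq_card.
have sum_deg : (\sum_v deg v = #|A|.*2)%N by rewrite big_split /= !sum_end addnn.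
pose W := [pred v | (0 < deg v)%N].
(* Touched vertices have degree at least 2, and the degrees add up to twice the number of edges in
   [A]. *)
have leWA : (#|W| <= #|A|)%N.
  rewrite -leq_double -sum_deg (bigID W) /= -sum1_card -mul2n big_distrr /=.
  rewrite (leq_trans _ (leq_addr _ _))//; apply: leq_sum => v; rewrite inE => Wv.
  by rewrite muln1 ltn_neqAle eq_sym deg1.
have Wv0 : W (src e0).
  by rewrite /= addn_gt0; apply/orP; left; apply/card_gt0P; exists e0; rewrite inE Ae0 /=.
(* The equations say that [z] vanishes off [A] and is balanced at the touched vertices other than
   [src e0]. *)
pose c e (y : {e | ~~ A e} + {v | W v && (v != src e0)}) : R :=
  match y with
  | inl e' => (e == val e')%:R
  | inr v => (tgt e == val v)%:R - (src e == val v)%:R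
  end.
have [|z [z0 zc]] := @homogeneous_solution R _ _ c.
  rewrite card_sum !card_sig.
  have -> : #|[pred v | W v && (v != src e0)]| = #|W|.-1.
    rewrite (cardD1 (src e0) W) -[src e0 \in W]/(W (src e0)) Wv0 add1n /=.
    by apply: eq_card => v; rewrite !inE andbC.
  have W0 : (0 < #|W|)%N by apply/card_gt0P; exists (src e0).
  rewrite -(cardC A) addnC ltn_add2r.
  by rewrite (leq_trans _ leWA) // prednK.
have zA e : ~~ A e -> z e = 0.
  move=> nAe; have /= := zc (inl (exist _ e nAe)).
  rewrite (bigD1 e) //= eqxx mulr1 big1 ?addr0// => i /negbTE ->.
  by rewrite mulr0.
pose d v := \sum_e z e * ((tgt e == v)%:R - (src e == v)%:R).
have dE v : d v = \sum_(e | tgt e == v) z e - \sum_(e | src e == v) z e.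
  rewrite /d [X in X - _]big_mkcond [X in _ - X]big_mkcond -sumrB.
  by apply: eq_bigr => e _; case: eqP; case: eqP; rewrite ?mulrBr ?mulr1 ?mulr0.
have d0 v : v != src e0 -> d v = 0.
  move=> vv0; case: (boolP (W v)) => Wv.
    by have := zc (inr (exist _ v (introT andP (conj Wv vv0)))).
  rewrite /d big1// => e _; case: (boolP (A e)) => [Ae|/zA ->]; last by rewrite mul0r.
  move: Wv; rewrite /= -leqNgt leqn0 addn_eq0 => /andP [/eqP/card0_eq s0 /eqP/card0_eq t0].
  have := s0 e; have := t0 e; rewrite !inE Ae /= => -> ->.
  by rewrite subrr mulr0.
have sumd : \sum_v d v = 0.
  rewrite /d exchange_big /= big1// => e _; rewrite -big_distrr /= sumrB.
  have one (u : V) : \sum_v ((u == v)%:R : R) = 1.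
    by rewrite (bigD1 u)//= eqxx big1 ?addr0// => i; rewrite eq_sym => /negbTE ->.
  by rewrite !one subrr mulr0.
exists z; split => // v; apply/eqP; rewrite -subr_eq0 -dE.
case: (eqVneq v (src e0)) => [->|/d0 ->//].
by rewrite -sumd (bigD1 (src e0))//= [X in _ == _ + X]big1 ?addr0.
Qed.

End Digraph.

Section Rounding.
Variables (V E : finType) (src tgt : E -> V) (R : archiRealFieldType).
Local Notation balanced := (balanced src tgt).

(** This confines [N e] to the interval from the floor to the ceiling of [y e]; stated through
    integer bounds, the relation composes along successive steps. *)
Definition rounds (y N : E -> R) := forall e (i : int),
  (i%:~R <= y e -> i%:~R <= N e) /\ (y e <= i%:~R -> N e <= i%:~R).

Definition fractional (y : E -> R) := [pred e | y e \isn't a Num.int].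

(** A lone fractional edge at [v] would, by the balance equation there, be a combination of
    integers. *)
Lemma fractional_degree (y : E -> R) v : balanced y ->
  (#|[pred e | fractional y e && (src e == v)]|
    + #|[pred e | fractional y e && (tgt e == v)]| != 1)%N.
Proof.
move=> yb; apply/negP => /eqP d1.
suff aux (f g : E -> V) :
    \sum_(e | f e == v) y e = \sum_(e | g e == v) y e ->
    #|[pred e | fractional y e && (f e == v)]| = 1%N ->
    #|[pred e | fractional y e && (g e == v)]| = 0%N -> False.
  move: d1 (aux src tgt (esym (yb v))) (aux tgt src (yb v)).
  case: #|[pred e | fractional y e && (src e == v)]| => [|[|?]].
  - by rewrite add0n => d1 _ h; exact: h.
  - by rewrite add1n => -[d1] h _; exact: h.
  - by [].
move=> yfg f1 /card0_eq g0.
have /card_gt0P [e] : (0 < #|[pred e | fractional y e && (f e == v)]|)%N.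
  by rewrite f1.
rewrite inE => /andP [ye fe]; move/negP: (ye); apply.
have -> : y e = \sum_(e | g e == v) y e - \sum_(i | (f i == v) && (i != e)) y i.
  by rewrite -yfg (bigD1 e)//= addrK.
rewrite rpredB// rpred_sum// => i.
  by move=> gi; have := g0 i; rewrite !inE gi andbT => /negbFE.
case/andP=> fi ie; move: f1; rewrite (cardD1 e) inE ye fe /= => -[] /card0_eq/(_ i).
by rewrite !inE ie fi andbT => /negbFE.
Qed.

(* Move along a circulation supported on the fractional edges, in the direction
   in which the total does not decrease, until one of them becomes integral. *)
Lemma rounding_step (y : E -> R) : balanced y -> (exists e, fractional y e) ->
  exists y', [/\ balanced y', rounds y y', \sum_e y e <= \sum_e y' e
    & (#|fractional y'| < #|fractional y|)%N].
Proof.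
move=> yb ex.
have [z [z0 zA zb zs]] : exists z : E -> R, [/\ exists e, z e != 0,
    forall e, ~~ fractional y e -> z e = 0, balanced z & 0 <= \sum_e z e].
  have [z [[e ze] zA zb]] := exists_circulation R ex (fun v => fractional_degree v yb).
  have [zs|/ltW zs] := leP 0 (\sum_e z e); first by exists z; split => //; exists e.
  exists (fun e => - z e); split.
  - by exists e; rewrite oppr_eq0.
  - by move=> i /zA ->; rewrite oppr0.
  - by move=> v; rewrite !sumrN zb.
  - by rewrite sumrN oppr_ge0.
have {ex}[e1 ze1] := z0.
(* [s e] is the time at which edge [e], moving at speed [z e], first reaches an integer; the edge
   [e2] that arrives first sets the step. *)
pose s e := if 0 < z e then ((Num.ceil (y e))%:~R - y e) / z e
            else (y e - (Num.floor (y e))%:~R) / - z e.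
have s_ge0 e : 0 <= s e.
  rewrite /s; case: ltP => ze.
    by rewrite divr_ge0 ?subr_ge0 ?ceil_ge// ltW.
  by rewrite divr_ge0 ?subr_ge0 ?floor_le// oppr_ge0.
have [e2 ze2 e2min] := @arg_minP _ _ _ e1 [pred e | z e != 0] s ze1.
exists (fun e => y e + s e2 * z e); split.
- by move=> v; rewrite !big_split /= -!mulr_sumr yb zb.
- move=> e i; have [->|ze] := eqVneq (z e) 0; first by rewrite mulr0 addr0.
  have := e2min e ze; have := s_ge0 e2; move: (s e2) => t t0.
  rewrite /s; case: ltP => ze'.
    rewrite ler_pdivlMr// lerBrDl => tz; split => [h|].
      by rewrite (le_trans h)// lerDl mulr_ge0// ltW.
    by rewrite -ceil_le_int -(ler_int R) => /(le_trans tz).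
  rewrite ler_pdivlMr ?oppr_gt0 ?lt_neqAle ?ze// mulrN lerNl opprB => tz; split => [|h].
    rewrite -floor_ge_int -(ler_int R) => /le_trans; apply.
    by rewrite -lerBlDl.
  by rewrite (le_trans _ h)// gerDl mulr_ge0_le0.
- by rewrite big_split /= -mulr_sumr lerDl mulr_ge0.
apply: proper_card; apply/properP; split.
  apply/fintype.subsetP => e; rewrite !inE; apply: contra => ye.
  by rewrite zA ?mulr0 ?addr0//= negbK.
exists e2; rewrite !inE; first by apply: contraR ze2 => /zA ->; rewrite /= eqxx.
rewrite negbK /s; case: ltP => ze.
  by rewrite divfK // addrC subrK intr_int.
by rewrite invrN mulrN mulNr divfK // opprB addrC subrK intr_int.
Qed.

Lemma real_rounding (y : E -> R) : balanced y ->
  exists y', [/\ balanced y', rounds y y', \sum_e y e <= \sum_e y' e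
    & forall e, y' e \is a Num.int].
Proof.
have [k] := ubnP #|fractional y|; elim: k y => // k IH y; rewrite ltnS => yk yb.
have [ex|nex] := pselect (exists e, fractional y e); last first.
  exists y; split => // e; apply: contra_notT nex => ye; by exists e.
have [y1 [y1b y1r y1s y1k]] := rounding_step yb ex.
have [y2 [y2b y2r y2s y2i]] := IH y1 (leq_trans y1k yk) y1b.
exists y2; split => //; last exact: le_trans y2s.
move=> e i; have [h1 h2] := y1r e i; have [h3 h4] := y2r e i.
by split => [/h1/h3|/h2/h4].
Qed.

(** Nonnegativity survives because 0 is an integer bound, so truncation is exact. The total must not
    drop, as it will bound the length of a walk from below. *)
Lemma rounding (y : E -> R) : (forall e, 0 <= y e) -> balanced y ->
  exists N : E -> nat,
    [/\ forall v, (\sum_(e | tgt e == v) N e = \sum_(e | src e == v) N e)%N,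
    forall e, y e - 1 <= (N e)%:R <= y e + 1
    & \sum_e y e <= (\sum_e N e)%N%:R].
Proof.
move=> y0 /real_rounding [y' [y'b y'r y's y'i]].
have y'0 e : 0 <= y' e by apply: (proj1 (y'r e 0)).
have y'E e : (Num.trunc (y' e))%:R = y' e.
  by apply/eqP; rewrite -natrEtruncn -intrEge0// y'i.
exists (fun e => Num.trunc (y' e)); split.
- move=> v; apply/eqP; rewrite -(eqr_nat R) !natr_sum.
  by rewrite (eq_bigr _ (fun e _ => y'E e)) y'b (eq_bigr _ (fun e _ => y'E e)).
- move=> e; rewrite y'E; apply/andP; split.
    rewrite (@le_trans _ _ (Num.floor (y e))%:~R)//.
      by have /andP [_] := floor_itv (y e); rewrite intrD lerBlDr => /ltW.
    exact/(proj1 (y'r e _))/floor_le.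
  rewrite (@le_trans _ _ (Num.ceil (y e))%:~R)//.
    exact/(proj2 (y'r e _))/ceil_ge.
  by have := ceilB1_lt (y e); rewrite intrB ltrBlDr => /ltW.
- by rewrite natr_sum (eq_bigr _ (fun e _ => y'E e)).
Qed.

End Rounding.

Lemma count_sum_mem (E : finType) (P : pred E) (p : seq E) :
  count P p = (\sum_(e | P e) count_mem e p)%N.
Proof.
elim: p => [|a p IH]; first by rewrite big1.
rewrite /= IH big_split /=; congr addn; case: (boolP (P a)) => Pa.
  rewrite (bigD1 a) //= eqxx big1 ?addn0 // => e /andP [_ ea].
  by rewrite eq_sym (negbTE ea).
rewrite big1 // => e Pe; case: eqP => // ae; move: Pa; by rewrite ae Pe.
Qed.

(** * Walks and Eulerian circuits *)

Section Walks.
Variables (V E : finType) (src tgt : E -> V).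

Fixpoint walk (r : V) (p : seq E) : bool :=
  if p is e :: p' then (src e == r) && walk (tgt e) p' else true.

Definition endpoint (r : V) (p : seq E) : V := last r (map tgt p).

Definition exits (p : seq E) (v : V) : seq E := [seq e <- p | src e == v].

(** Along a walk every entry is followed by an exit, apart from the start and the end. *)
Lemma walk_flow r p v : walk r p ->
  (count (fun e => tgt e == v) p + (r == v)
   = count (fun e => src e == v) p + (endpoint r p == v))%N.
Proof.
elim: p r => [|e p IH] r //= /andP [/eqP <-] /IH; rewrite /endpoint /=.
lia.
Qed.

(** [T v] lists the exits of [v] in the order of use. Following these lists greedily until stuck
    consumes one entry per step, hence terminates. *)
Lemma maximal_walk (T : V -> seq E) r :
  (forall v, all (fun e => src e == v) (T v)) ->
  exists p, [/\ walk r p, forall v, prefix (exits p v) (T v)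
    & exits p (endpoint r p) = T (endpoint r p)].
Proof.
have [k] := ubnP (\sum_v size (T v)).
elim: k T r => // k IH T r; rewrite ltnS => Tk Tsrc.
case Tr: (T r) => [|e t].
  exists [::]; split => [||]; rewrite /exits /endpoint /= ?Tr //.
  by move=> v; rewrite prefix0s.
pose T' v := if v == r then t else T v.
have /= := Tsrc r; rewrite Tr /= => /andP [/eqP er tr].
have [||p [p1 p2 p3]] := IH T' (tgt e).
- rewrite (leq_trans _ Tk)// (bigD1 r)//= [X in (_ < X)%N](bigD1 r)//= /T' eqxx Tr /=.
  by rewrite addSn ltnS leq_add2l; apply/eq_leq/eq_bigr => v /negbTE ->.
- by move=> v; rewrite /T'; case: eqP => [->|].
exists (e :: p); split.
- by rewrite /= er eqxx.
- move=> v; have := p2 v; rewrite /exits /T' /= er [v == r]eq_sym.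
  by case: (r =P v) => [<-|//]; rewrite ?Tr ?prefix_cons ?eqxx.
- move: p3; rewrite /exits /T' /endpoint /= er [_ == r]eq_sym.
  by case: (r =P _) => [<- ->|//]; rewrite ?Tr.
Qed.

(** The setting of the BEST theorem: the last exits [b v] of the vertices other than [r] form a tree
    directed towards the root [r]. *)
Variables (M : E -> nat) (T : V -> seq E) (r : V) (b : V -> E).
Hypothesis M_bal : forall v,
  (\sum_(e | tgt e == v) M e = \sum_(e | src e == v) M e)%N.
Hypothesis T_count : forall v e,
  count_mem e (T v) = (if src e == v then M e else 0)%N.
Hypothesis T_last : forall v, v != r -> exists s, T v = rcons s (b v).
Hypothesis b_root : forall v, exists k, iter k (tgt \o b) v = r.

Lemma size_table v : size (T v) = (\sum_(e | src e == v) M e)%N.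
Proof.
rewrite -count_predT count_sum_mem [RHS]big_mkcond /=.
by apply: eq_bigr => e _; rewrite T_count.
Qed.

(* If the walk has used every exit of [tgt (b v)] then, being closed, it has
   used every entry, in particular [b v], which is the last exit of [v]. *)
Lemma eulerian_circuit : exists2 p, walk r p & forall v, exits p v = T v.
Proof.
have Tsrc v : all (fun e => src e == v) (T v).
  apply/allP => e; rewrite -has_pred1 has_count T_count.
  by case: ifP.
have [p [pw pT pend]] := maximal_walk r Tsrc.
exists p => //.
have sub e : (count_mem e p <= count_mem e (T (src e)))%N.
  have -> : count_mem e p = count_mem e (exits p (src e)).
    rewrite /exits count_filter; apply: eq_in_count => f _ /=.
    by case: eqP => // ->; rewrite eqxx.
  by have /prefixP [s ->] := pT (src e); rewrite count_cat leq_addr.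
have subM e : (count_mem e p <= M e)%N by have := sub e; rewrite T_count eqxx.
have outE v : count (fun e => src e == v) p = size (exits p v).
  by rewrite size_filter.
(* A walk stuck elsewhere would have entered its endpoint once more often than it left it, exceeding
   the supply of entries. *)
have end_r : endpoint r p = r.
  apply/eqP; apply: contraT => ur; have := walk_flow (endpoint r p) pw.
  rewrite eqxx [r == _]eq_sym (negbTE ur) outE pend size_table -M_bal addn0.
  rewrite count_sum_mem => h.
  have : (\sum_(e | tgt e == endpoint r p) count_mem e p
          <= \sum_(e | tgt e == endpoint r p) M e)%N by exact: leq_sum.
  by rewrite h addn1 ltnn.
have flow v : count (fun e => tgt e == v) p = size (exits p v).
  by have := walk_flow v pw; rewrite end_r outE => /addIn.
(* Induction on the distance to the root along [b]. *)
suff key k v : iter k (tgt \o b) v = r -> exits p v = T v.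
  by move=> v; have [k /key] := b_root v.
elim: k v => [v /= ->|k IH v]; first by move: pend; rewrite end_r.
rewrite iterSr /= => /IH full.
have [->|vr] := eqVneq v r; first by move: pend; rewrite end_r.
have bE : count_mem (b v) p = M (b v).
  have := flow (tgt (b v)); rewrite full size_table -M_bal count_sum_mem.
  rewrite (bigD1 (b v))//= [RHS](bigD1 (b v))//= => h.
  have : (\sum_(e | (tgt e == tgt (b v)) && (e != b v)) count_mem e p
    <= \sum_(e | (tgt e == tgt (b v)) && (e != b v)) M e)%N by exact: leq_sum.
  by rewrite -(leq_add2l (count_mem (b v) p)) h leq_add2r => hb; apply/eqP; rewrite eqn_leq subM.
have [s Ts] := T_last vr.
have srcb : src (b v) = v.
  by have /allP/(_ (b v)) := Tsrc v; rewrite Ts mem_rcons inE eqxx => /(_ isT)/eqP.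
have /prefixP [s2 Ts2] := pT v.
case/lastP: s2 Ts2 => [|s2 x] Ts2; first by rewrite Ts2 cats0.
have xb : x = b v.
  by have := congr1 (last x) Ts2; rewrite Ts last_rcons last_cat last_rcons => ->.
have := congr1 (count_mem (b v)) Ts2.
rewrite T_count srcb eqxx count_cat -cats1 count_cat /= xb eqxx.
have -> : count_mem (b v) (exits p v) = count_mem (b v) p.
  rewrite /exits count_filter; apply: eq_in_count => f _ /=.
  by case: eqP => // ->; rewrite srcb eqxx.
by rewrite bE; lia.
Qed.

End Walks.

(** * Counting sequences and walks *)

Lemma sum_tuple_cons (R : nmodType) (T : finType) n (f : n.+1.-tuple T -> R) :
  \sum_t f t = \sum_(t : n.-tuple T) \sum_a f [tuple of a :: t].
Proof.
rewrite pair_big /= (reindex (fun p : n.-tuple T * T => [tuple of p.2 :: p.1])) //=.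
exists (fun t : n.+1.-tuple T => ([tuple of behead t], thead t)) => [[t a] _|t _] /=.
  by congr pair; apply: val_inj.
by rewrite -tuple_eta.
Qed.

Definition with_counts (E : finType) (c : E -> nat) : pred (seq E) :=
  fun t => [forall e, count_mem e t == c e].

(** The multinomial coefficient, cleared of denominators. A first letter [a] takes one factor [c a]
    out of the product of factorials, and the [c a] add up to the length. *)
Lemma card_with_counts (E : finType) (c : E -> nat) n : (\sum_e c e = n)%N ->
  (#|[pred t : n.-tuple E | with_counts c t]| * \prod_e (c e)`! = n`!)%N.
Proof.
elim: n c => [|n IH] c cn.
  have c0 e : c e = 0%N.
    by move/eqP: cn; rewrite sum_nat_eq0 => /forallP/(_ e)/eqP.
  rewrite big1 ?muln1 => [|e _]; last by rewrite c0.
  rewrite (eq_card (B := [pred t : 0.-tuple E | true])) ?card_tuple // => t.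
  by rewrite !inE; apply/forallP => e; rewrite tuple0 c0.
rewrite -sum1_card big_mkcond /= sum_tuple_cons exchange_big /=.
pose d a e := (c e - (a == e))%N.
have step a : ((\sum_(t : n.-tuple E)
      (if with_counts c [tuple of a :: t] then 1 else 0)) * \prod_e (c e)`!
    = c a * n`!)%N.
  have [ca|ca] := posnP (c a).
    rewrite ca big1 ?mul0n // => t _; case: ifP => // /forallP/(_ a).
    by rewrite ca /= eqxx.
  rewrite -big_mkcond sum1_card.
  have dn : (\sum_e d a e = n)%N.
    rewrite (bigD1 a)//= (eq_bigr c) => [|e ea]; last first.
      by rewrite /d eq_sym (negbTE ea) subn0.
    by move: cn; rewrite (bigD1 a)//= /d eqxx; lia.
  rewrite -(IH _ dn).
  have -> : (\prod_e (c e)`! = c a * \prod_e (d a e)`!)%N.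
    rewrite (bigD1 a) //= [in RHS](bigD1 a) //= /d eqxx mulnA.
    rewrite -(prednK ca) factS subn1 /=; congr muln.
    by apply: eq_bigr => e ea; rewrite eq_sym (negbTE ea) subn0.
  rewrite mulnCA; congr (_ * (_ * _))%N; apply: eq_card => t; rewrite !inE.
  apply: eq_forallb => e; rewrite /d /=.
  by case: (eqVneq a e) ca => [->|_] ca /=; lia.
rewrite big_distrl /= (eq_bigr _ (fun a _ => step a)) -big_distrl /= cn.
by rewrite factS.
Qed.

(** * Stirling estimates and the function t ln t *)

Section XlnX.
Variable R : realType.

Definition xlnx (t : R) : R := t * ln t.

(** The tangent line of the concave function [ln] at [x]. *)
Lemma ler_ln_sub (x y : R) : 0 < x -> 0 < y -> ln y - ln x <= (y - x) / x.
Proof.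
move=> x0 y0; rewrite -ln_div ?posrE//.
have -> : y / x = 1 + (y - x) / x.
  by rewrite mulrBl divff ?gt_eqF// addrC subrK.
apply: le_ln1Dx; rewrite mulrBl divff ?gt_eqF//.
by have := divr_gt0 y0 x0; lra.
Qed.

(** The induction step amounts to n (ln (n + 1) - ln n) <= 1. *)
Lemma ln_fact_ge n : xlnx n%:R - n%:R <= ln (n`!%:R : R).
Proof.
elim: n => [|n IH]; first by rewrite /xlnx mul0r subr0 ln1.
have n1 : 0 < n.+1%:R :> R by rewrite ltr0n.
rewrite factS natrM lnM ?posrE ?ltr0n ?fact_gt0//.
apply: le_trans (lerD (lexx _) IH); rewrite /xlnx -natr1.
case: n {IH} n1 => [|n] n1; first by rewrite !add0r ln1; lra.
have := @ler_ln_sub n.+1%:R n.+2%:R (ltr0Sn _ _) (ltr0Sn _ _).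
rewrite -[n.+2%:R]natr1 [X in X / _]addrAC subrr add0r div1r => h.
have : n.+1%:R * (ln (n.+1%:R + 1) - ln n.+1%:R) <= n.+1%:R * n.+1%:R^-1 :> R.
  by rewrite ler_pM2l// ltr0n.
rewrite divff ?pnatr_eq0//; lra.
Qed.

Lemma ln_fact_le n :
  ln (n`!%:R : R) <= xlnx n%:R - n%:R + ln n.+1%:R + 1.
Proof.
(* The intermediate bound is sharp enough for an induction; afterwards n ln (n + 1) is bounded by n
   ln n + 1. *)
apply: (@le_trans _ _ (n.+1%:R * ln n.+1%:R - n%:R)).
  elim: n => [|n IH]; first by rewrite ln1 mulr0 subr0.
  rewrite factS natrM lnM ?posrE ?ltr0n ?fact_gt0//.
  apply: le_trans (lerD (lexx _) IH) _.
  have := @ler_ln_sub n.+2%:R n.+1%:R (ltr0Sn _ _) (ltr0Sn _ _).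
  rewrite -[X in (_ - X) / _]natr1 opprD addrA subrr add0r.
  move=> h.
  have : n.+2%:R * (ln n.+1%:R - ln n.+2%:R) <= n.+2%:R * (-1 / n.+2%:R) :> R.
    by rewrite ler_pM2l// ltr0n.
  rewrite mulrCA divff ?pnatr_eq0// mulr1 -!natr1; lra.
rewrite /xlnx; case: n => [|n]; first by rewrite ln1; lra.
have := @ler_ln_sub n.+1%:R n.+2%:R (ltr0Sn _ _) (ltr0Sn _ _).
rewrite -[n.+2%:R]natr1 [X in X / _]addrAC subrr add0r div1r => h.
have : n.+1%:R * (ln (n.+1%:R + 1) - ln n.+1%:R) <= n.+1%:R * n.+1%:R^-1 :> R.
  by rewrite ler_pM2l// ltr0n.
rewrite divff ?pnatr_eq0//; lra.
Qed.

Lemma ln_prod (I : finType) (P : pred I) (f : I -> R) : (forall i, P i -> 0 < f i) ->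
  ln (\prod_(i | P i) f i) = \sum_(i | P i) ln (f i).
Proof.
move=> f0; suff [] : 0 < \prod_(i | P i) f i /\
  ln (\prod_(i | P i) f i) = \sum_(i | P i) ln (f i) by [].
elim/big_rec2: _ => [|i x y Pi [x0 xy]]; first by rewrite ln1.
by rewrite lnM ?posrE ?f0// xy mulr_gt0// f0.
Qed.

(** Stirling's linear terms cancel, since the counts add up to [n]. Positivity is stated separately
    because [ln 0 = 0]. *)
Lemma ln_card_with_counts (E : finType) (c : E -> nat) n : (\sum_e c e = n)%N ->
  xlnx n%:R - \sum_e xlnx (c e)%:R - #|E|%:R * (ln n.+1%:R + 1)
    <= ln (#|[pred t : n.-tuple E | with_counts c t]|%:R : R)
  /\ (0 < #|[pred t : n.-tuple E | with_counts c t]|)%N.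
Proof.
move=> cn; have := card_with_counts cn; set A := #|_| => Ac.
have A0 : (0 < A)%N.
  by rewrite lt0n; apply: contra_eq_neq Ac => ->; rewrite mul0n eq_sym -lt0n fact_gt0.
split => //; have := ln_fact_ge n.
have P0 : (0 < \prod_e (c e)`!)%N by rewrite prodn_gt0// => e; exact: fact_gt0.
rewrite -Ac natrM lnM ?posrE ?ltr0n//.
suff : ln (\prod_e (c e)`!)%N%:R <= \sum_e xlnx (c e)%:R - n%:R
    + #|E|%:R * (ln n.+1%:R + 1) :> R by lra.
have -> : ln (\prod_e (c e)`!)%N%:R = \sum_e ln (c e)`!%:R :> R.
  by rewrite natr_prod ln_prod// => e _; rewrite ltr0n fact_gt0.
have -> : #|E|%:R * (ln n.+1%:R + 1) = \sum_(e : E) (ln n.+1%:R + 1) :> R.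
  by rewrite sumr_const mulr_natl.
have -> : n%:R = \sum_e (c e)%:R :> R by rewrite -cn natr_sum.
rewrite -sumrB -big_split /=; apply: ler_sum => e _.
apply: le_trans (ln_fact_le _) _; rewrite -addrA lerD2l lerD2r ler_ln ?posrE ?ltr0n//.
by rewrite ler_nat ltnS -cn (bigD1 e)//= leq_addr.
Qed.

(* [ln] vanishes on the negative reals, so [xlnx] is continuous everywhere. *)
Lemma continuous_xlnx : continuous xlnx.
Proof.
move=> x; have [x0|x0|->] := ltgtP x 0; last 2 first.
- by apply: cvgM; [exact: cvg_id|exact: continuous_ln].
- apply/cvgrPdist_lt => e e0; apply/nbhs_ballP.
  (* With s the square root of y, the tangent bound - ln s <= (1 - s) / s gives |y ln y| <= 2 s (1 -
     s), which is below [e] once s < e / 2. *)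
  exists (Num.min 1 ((e / 2) ^+ 2)).
    by rewrite /= lt_min ltr01 exprn_gt0// divr_gt0.
  move=> y /=; rewrite /ball /= sub0r normrN lt_min => /andP [y1 ye].
  rewrite {1}/xlnx mul0r sub0r normrN.
  have [y0|y0] := leP y 0; first by rewrite /xlnx ln0// mulr0 normr0.
  rewrite (gtr0_norm y0) in y1 ye.
  have s0 : 0 < Num.sqrt y by rewrite sqrtr_gt0.
  have sy : Num.sqrt y ^+ 2 = y by rewrite sqr_sqrtr// ltW.
  have se : Num.sqrt y < e / 2.
    by rewrite -(@ltr_pXn2r _ 2)// ?nnegrE ?sy// ltW// divr_gt0.
  have yl : ln y <= 0 by rewrite ln_le0// ltW.
  rewrite /xlnx normrM gtr0_norm// ler0_norm//.
  have := @ler_ln_sub (Num.sqrt y) 1 s0 ltr01; rewrite ln1 sub0r => h.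
  have -> : ln y = 2 * ln (Num.sqrt y).
    by rewrite -{1}sy expr2 lnM ?posrE//; ring.
  rewrite -{1}sy.
  have : Num.sqrt y * - ln (Num.sqrt y) <= Num.sqrt y * ((1 - Num.sqrt y) / Num.sqrt y).
    by rewrite ler_pM2l.
  rewrite mulrCA divff ?gt_eqF// mulr1 => h'.
  have : Num.sqrt y * (Num.sqrt y * - ln (Num.sqrt y)) <= Num.sqrt y * (1 - Num.sqrt y).
    by rewrite ler_pM2l.
  have := mulr_gt0 s0 s0; lra.
- apply/cvgrPdist_lt => e e0; apply/nbhs_ballP.
  exists (- x); first by rewrite /= oppr_gt0.
  move=> y /=; rewrite /ball /= => xy.
  have y0 : y <= 0 by move: xy; rewrite ltr_norml => /andP [h _]; lra.
  by rewrite /xlnx !ln0 ?mulr0 ?subrr ?normr0// ltW.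
Qed.

Lemma xlnxM (c t : R) : 0 < c -> 0 <= t -> xlnx (c * t) = c * xlnx t + c * t * ln c.
Proof.
move=> c0; rewrite le_eqVlt => /predU1P [<-|t0].
  by rewrite /xlnx !(mulr0, mul0r) addr0.
by rewrite /xlnx lnM ?posrE//; ring.
Qed.

End XlnX.

Lemma cvg_sumr (R : realType) (T : Type) (F : set_system T) {FF : Filter F}
    (I : Type) (s : seq I) (P : pred I) (f : I -> T -> R) (l : I -> R) :
  (forall i, P i -> f i t @[t --> F] --> l i) ->
  \sum_(i <- s | P i) f i t @[t --> F] --> \sum_(i <- s | P i) l i.
Proof.
move=> fl; elim: s => [|i s IH].
  by rewrite big_nil; under eq_fun do rewrite big_nil; exact: cvg_cst.
rewrite big_cons; under eq_fun do rewrite big_cons.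
by case: ifP => // Pi; apply: cvgD => //; exact: fl.
Qed.

(** * Entropy of edge weights and the number of circuits *)

Section Counting.
Variables (R : realType) (V E : finType) (src tgt : E -> V).

(** For a probability this is the conditional entropy, in nats, of an edge given its source. Without
    normalisation it applies to edge counts as well. *)
Definition entropy (x : E -> R) : R :=
  \sum_v xlnx (\sum_(e | src e == v) x e) - \sum_e xlnx (x e).

(** Both sums carry the total weight of [x], so the terms in [ln c] cancel. *)
Lemma entropyM (c : R) (x : E -> R) : 0 < c -> (forall e, 0 <= x e) ->
  entropy (fun e => c * x e) = c * entropy x.
Proof.
move=> c0 x0; rewrite /entropy.
have -> : \sum_v xlnx (\sum_(e | src e == v) c * x e)
  = c * (\sum_v xlnx (\sum_(e | src e == v) x e)) + c * (\sum_e x e) * ln c.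
  rewrite (partition_big src xpredT)//= !mulr_sumr mulr_suml -big_split /=.
  by apply: eq_bigr => v _; rewrite -mulr_sumr xlnxM// sumr_ge0.
have -> : \sum_e xlnx (c * x e) = c * (\sum_e xlnx (x e)) + c * (\sum_e x e) * ln c.
  rewrite !mulr_sumr mulr_suml -big_split /=.
  by apply: eq_bigr => v _; rewrite xlnxM.
ring.
Qed.

Lemma cvg_entropy (T : Type) (F : set_system T) {FF : Filter F}
    (x : T -> E -> R) (y : E -> R) :
  (forall e, x t e @[t --> F] --> y e) ->
  entropy (x t) @[t --> F] --> entropy y.
Proof.
move=> xy; rewrite /entropy; apply: cvgB.
  apply: cvg_sumr => v _; apply: continuous_cvg; first exact: continuous_xlnx.
  by apply: cvg_sumr.
by apply: cvg_sumr => e _; apply: continuous_cvg; first exact: continuous_xlnx.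
Qed.

Variables (r : V) (b : V -> E).
Hypothesis src_b : forall v, src (b v) = v.
Hypothesis b_root : forall v, exists k, iter k (tgt \o b) v = r.

(* A circuit is determined by the lists of exits of the vertices; these may be
   chosen freely except that the last exit of [v] is [b v], whence the truncated
   subtraction of one copy of [b v] from the counts. *)
Lemma many_circuits (M : E -> nat) (L : nat) :
  (forall v, (\sum_(e | tgt e == v) M e = \sum_(e | src e == v) M e)%N) ->
  (forall e, (0 < M e)%N) -> (\sum_e M e = L)%N ->
  expR (entropy (fun e => (M e - (e == b (src e)))%N%:R)
        - #|V|%:R * (#|E|%:R * (ln L.+1%:R + 1)))
  <= #|[pred p : L.-tuple E | walk src tgt r p && with_counts M p]|%:R.
Proof.
move=> Mbal M0 ML.
pose M' e := (M e - (e == b (src e)))%N.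
pose c v e := (if src e == v then M' e else 0)%N.
pose n v := (\sum_e c v e)%N.
have nL v : (n v <= L)%N.
  rewrite -ML; apply: leq_sum => e _; rewrite /c /M'; case: ifP => _ //.
  exact: leq_subr.
pose FT : finType := {dffun forall v, (n v).-tuple E}.
pose Fam : simpl_pred FT :=
  family (fun v => [pred t : (n v).-tuple E | with_counts (c v) t]).
pose T (f : FT) v := rcons (f v) (b v).
have Tcount (f : FT) : f \in Fam -> forall v e,
    count_mem e (T f v) = (if src e == v then M e else 0)%N.
  move=> /familyP fF v e; have := fF v; rewrite inE => /forallP/(_ e)/eqP fve.
  rewrite /T -cats1 count_cat fve /= /c /M' addn0.
  have := M0 e; case: (eqVneq (src e) v) => [<-|sv]; first by rewrite eq_sym; case: eqP => _ /=; lia.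
  case: eqP => // be; by rewrite -be src_b eqxx in sv.
(* Tables outside [Fam] get a dummy tuple, so that a choice function can be taken on all of [FT]. *)
have ex (f : FT) : exists p : L.-tuple E, f \in Fam ->
    [/\ walk src tgt r p, with_counts M p & forall v, exits src p v = T f v].
  case: (boolP (f \in Fam)) => fF; last first.
    have : (0 < #|E|)%N by apply/card_gt0P; exists (b r).
    by move=> /card_gt0P [e _]; exists [tuple of nseq L e].
  have [p pw pT] := eulerian_circuit Mbal (Tcount f fF)
    (fun v _ => ex_intro _ (tval (f v)) erefl) b_root.
  have pM e : count_mem e p = M e.
    have := Tcount f fF (src e) e; rewrite eqxx => <-.
    rewrite -pT /exits count_filter; apply: eq_in_count => f' _ /=.
    by case: eqP => // ->; rewrite eqxx.
  have ps : size p == L.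
    rewrite -count_predT count_sum_mem -ML; apply/eqP/eq_bigr => e _; exact: pM.
  exists (Tuple ps) => _; split => //.
  by apply/forallP => e; apply/eqP/pM.
have [g gP] := boolp.choice ex.
have inj : {in Fam &, injective g}.
  move=> f1 f2 /gP [_ _ g1] /gP [_ _ g2] g12; apply/ffunP => v; apply: val_inj.
  by have := g1 v; rewrite g12 g2 /T => /rcons_inj [].
have : (#|Fam| <= #|[pred p : L.-tuple E | walk src tgt r p && with_counts M p]|)%N.
  rewrite -(card_in_image inj); apply: subset_leq_card; apply/fintype.subsetP => p.
  by case/fintype.imageP => f /gP [h1 h2 _] ->; rewrite inE h1.
rewrite -(ler_nat R); apply: le_trans.
rewrite card_family foldrE big_map big_enum /= natr_prod.
have cnt v := @ln_card_with_counts R E (c v) (n v) erefl.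
have pos v : 0 < #|[pred t : (n v).-tuple E | with_counts (c v) t]|%:R :> R.
  by rewrite ltr0n; case: (cnt v).
rewrite -ler_ln ?posrE ?expR_gt0//; last by apply: prodr_gt0.
rewrite expRK ln_prod//.
apply: le_trans (ler_sum _ (fun v _ => (cnt v).1)).
rewrite !sumrB /entropy lerB//.
  rewrite lerB//.
    by apply: ler_sum => v _; rewrite /n /c -big_mkcond natr_sum.
  rewrite exchange_big /=; apply: ler_sum => e _.
  rewrite (bigD1 (src e))//= /c eqxx big1 ?addr0// => v.
  by rewrite eq_sym => /negbTE ->; rewrite /xlnx mul0r.
have -> : #|V|%:R * (#|E|%:R * (ln L.+1%:R + 1))
    = \sum_(v : V) #|E|%:R * (ln L.+1%:R + 1) :> R by rewrite sumr_const mulr_natl.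
apply: ler_sum => v _; rewrite ler_wpM2l// lerD2r ler_ln ?posrE ?ltr0n// ler_nat ltnS; exact: nL.
Qed.

End Counting.

Section FewWalks.
Variables (R : realType) (V E : finType) (src tgt : E -> V).

Lemma prod_count_mem (q : E -> R) (p : seq E) :
  \prod_(e <- p) q e = \prod_e q e ^+ count_mem e p.
Proof.
elim: p => [|a p IH]; first by rewrite big_nil big1.
rewrite big_cons IH [RHS](bigD1 a)//= [in LHS](bigD1 a)//= eqxx exprS mulrA.
congr (_ * _); apply: eq_bigr => e ea.
by rewrite [a == e]eq_sym (negbTE ea).
Qed.

(** Total probability under a substochastic chain, by splitting off the first edge. *)
Lemma walk_weight_le1 (q : E -> R) (L : nat) (r : V) :
  (forall e, 0 <= q e) -> (forall v, \sum_(e | src e == v) q e <= 1) ->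
  \sum_(p : L.-tuple E | walk src tgt r p) \prod_(e <- p) q e <= 1.
Proof.
move=> q0 q1; elim: L r => [|L IH] r.
  apply: (@le_trans _ _ (\sum_(p : 0.-tuple E) 1)).
    rewrite [X in _ <= X](bigID (fun p : 0.-tuple E => walk src tgt r p))/=.
    rewrite -[X in X <= _]addr0 lerD ?sumr_ge0// ler_sum// => p _.
    by rewrite tuple0 big_nil.
  by rewrite sumr_const card_tuple.
rewrite big_mkcond sum_tuple_cons exchange_big /=.
apply: le_trans (q1 r); rewrite [X in _ <= X]big_mkcond; apply: ler_sum => a _ /=.
case: ifP => _ /=; last by rewrite big1.
rewrite -big_mkcond (eq_bigr (fun p : L.-tuple E => q a * \prod_(e <- p) q e)) => [|p _].
  by rewrite -mulr_sumr -[X in _ <= X]mulr1 ler_wpM2l.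
by rewrite big_cons.
Qed.

(* All these walks have the same weight [expR (- entropy)] under the Markov chain
   with transition probabilities [N e / N (src e)]. *)
Lemma few_walks (N : E -> nat) (L : nat) (r : V) :
  #|[pred p : L.-tuple E | walk src tgt r p && with_counts N p]|%:R
  <= expR (entropy src (fun e => (N e)%:R : R)).
Proof.
pose N1 v : R := \sum_(e | src e == v) (N e)%:R.
(* A vertex without counted exits has [N1 = 0]; as division by 0 gives 0, its row sums to 0 and not
   to 1. *)
pose q e : R := (N e)%:R / N1 (src e).
have N1_ge0 v : 0 <= N1 v by rewrite sumr_ge0.
have q0 e : 0 <= q e by rewrite divr_ge0.
have q1 v : \sum_(e | src e == v) q e <= 1.
  rewrite (eq_bigr (fun e => (N e)%:R / N1 v)) => [|e /eqP <-//].
  rewrite -mulr_suml -/(N1 v); have [->|Nv] := eqVneq (N1 v) 0.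
    by rewrite mul0r.
  by rewrite divff.
have weight (p : seq E) : with_counts N p ->
    \prod_(e <- p) q e = expR (- entropy src (fun e => (N e)%:R : R)).
  move=> /forallP pN; rewrite prod_count_mem /entropy opprB.
  have -> : \sum_v xlnx (\sum_(e | src e == v) (N e)%:R)
      = \sum_e (N e)%:R * ln (N1 (src e)) :> R.
    rewrite [RHS](partition_big src xpredT)//=; apply: eq_bigr => v _.
    by rewrite /xlnx mulr_suml; apply: eq_bigr => e /eqP <-.
  rewrite -sumrB; elim/big_rec2: _ => [|e x y _ ->]; first by rewrite expR0.
  rewrite expRD; congr (_ * _); rewrite (eqP (pN e)) /xlnx -mulrBr.
  have [->|Ne] := posnP (N e); first by rewrite mul0r expR0.
  have N1e : 0 < N1 (src e).
    by rewrite /N1 (bigD1 e)//= ltr_pwDl ?ltr0n ?sumr_ge0.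
  rewrite expRM_natl -ln_div ?posrE ?ltr0n// lnK// posrE divr_gt0//.
  by rewrite ltr0n.
have := walk_weight_le1 L r q0 q1.
rewrite (bigID (fun p : L.-tuple E => with_counts N p))/=.
set A := \sum_(_ | _ && with_counts _ _) _; set B := \sum_(_ | _) _ => AB.
have B0 : 0 <= B by apply: sumr_ge0 => p _; apply: prodr_ge0.
have : A <= 1 by apply: le_trans AB; rewrite lerDl.
rewrite /A (eq_bigr (fun=> expR (- entropy src (fun e => (N e)%:R : R)))).
  rewrite sumr_const -[_ *+ _]mulr_natl expRN ler_pdivrMr ?expR_gt0// mul1r.
  by apply: le_trans; rewrite ler_nat; apply/eq_leq/eq_card => p.
by move=> p /andP [_ /weight].
Qed.

End FewWalks.

(** * The de Bruijn graph *)

Section DeBruijn.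
Variables (Sigma : finType) (m : nat).
Local Notation V := (m.-tuple Sigma).
Local Notation E := (m.+1.-tuple Sigma).

Definition esrc (e : E) : V := [tuple of belast (thead e) (behead e)].
Definition etgt (e : E) : V := [tuple of behead e].
Definition elast (e : E) : Sigma := last (thead e) (behead e).
Definition ext (v : V) (a : Sigma) : E := [tuple of rcons v a].

Lemma thead_behead (e : E) : tval e = thead e :: behead e.
Proof. by rewrite [in LHS](tuple_eta e). Qed.

Lemma val_src_last (e : E) : tval e = rcons (esrc e) (elast e).
Proof. by rewrite /= -lastI -thead_behead. Qed.

Lemma ext_srcK (e : E) : ext (esrc e) (elast e) = e.
Proof. by apply: val_inj; rewrite [RHS]val_src_last. Qed.

Lemma esrc_ext v a : esrc (ext v a) = v.
Proof.
apply: val_inj; have := val_src_last (ext v a).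
by rewrite [LHS]/= => /rcons_inj [].
Qed.

Lemma elast_ext v a : elast (ext v a) = a.
Proof.
have := val_src_last (ext v a).
by rewrite [LHS]/= => /rcons_inj [].
Qed.

Lemma sum_esrc (R : nmodType) (f : E -> R) v :
  \sum_(e | esrc e == v) f e = \sum_a f (ext v a).
Proof.
rewrite (reindex_onto (ext v) elast) => [|e /eqP <-]; last exact: ext_srcK.
by apply: eq_bigl => a; rewrite esrc_ext elast_ext !eqxx.
Qed.

Lemma sum_etgt (R : nmodType) (f : E -> R) v :
  \sum_(e | etgt e == v) f e = \sum_a f [tuple of a :: v].
Proof.
rewrite (reindex_onto (fun a => [tuple of a :: v]) (@thead _ _)).
  apply: eq_bigl => a; rewrite theadE eqxx andbT.
  by apply/eqP/val_inj.
by move=> e /eqP <-; apply: val_inj; rewrite /= -thead_behead.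
Qed.

(** The vertex is the memory of the last [m] letters, and reading a letter crosses one edge; so
    words correspond to walks from [r] of the same length. *)
Fixpoint edges_of (r : V) (w : seq Sigma) : seq E :=
  if w is a :: w' then ext r a :: edges_of (etgt (ext r a)) w' else [::].

Lemma size_edges_of r w : size (edges_of r w) = size w.
Proof. by elim: w r => //= a w IH r; rewrite IH. Qed.

Lemma walk_edges_of r w : walk esrc etgt r (edges_of r w).
Proof. by elim: w r => //= a w IH r; rewrite esrc_ext eqxx IH. Qed.

Lemma edges_ofK r : cancel (edges_of r) (map elast).
Proof. by move=> w; elim: w r => //= a w IH r; rewrite elast_ext IH. Qed.

Lemma walk_edgesE r p : walk esrc etgt r p -> p = edges_of r (map elast p).
Proof.
elim: p r => //= e p IH r /andP [/eqP <- /IH ->].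
by rewrite ext_srcK edges_ofK.
Qed.

Lemma edges_of_cat r w1 w2 : edges_of r (w1 ++ w2)
  = edges_of r w1 ++ edges_of (endpoint etgt r (edges_of r w1)) w2.
Proof. by elim: w1 r => //= a w IH r; rewrite IH. Qed.

Lemma nth_edges_of e0 r w i : (i < size w)%N ->
  tval (nth e0 (edges_of r w) i) = take m.+1 (drop i (r ++ w)).
Proof.
elim: w r i => // a w IH r [|i] /= iw.
  by rewrite drop0 -cat_rcons take_size_cat// size_rcons size_tuple.
rewrite IH//; congr take; rewrite -cat_rcons /=.
by case: (rcons r a) (size_rcons r a).
Qed.

Lemma val_endpoint r w : tval (endpoint etgt r (edges_of r w)) = drop (size w) (r ++ w).
Proof.
elim: w r => [|a w IH] r; first by rewrite /endpoint /= cats0 drop0.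
rewrite /endpoint /= -/(endpoint etgt _ _) IH -cat_rcons /=.
by case: (rcons r a) (size_rcons r a).
Qed.

Definition has_suffix (phi : seq Sigma) (e : E) := drop (m.+1 - size phi) e == phi.

Definition occurrences (phi w : seq Sigma) : nat :=
  #|[set i : 'I_(size w - size phi).+1 | take (size phi) (drop i w) == phi]%SET|.

Lemma occurrences_count (phi w : seq Sigma) : occurrences phi w
  = count (fun i => take (size phi) (drop i w) == phi) (iota 0 (size w - size phi).+1).
Proof.
rewrite /occurrences -sum1_card -sum1_count -[_.+1 in RHS]subn0 -/(index_iota _ _).
by rewrite big_mkord; apply: eq_bigl => i; rewrite inE.
Qed.

(* The [i]-th edge carries the [m.+1] letters of [r ++ w] that end with the
   [i]-th letter of [w], so suffixes of edges see the occurrences in [w] by their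
   last letter; at most [m] of them overlap [r]. *)
Lemma count_has_suffix (r : V) (phi w : seq Sigma) :
  (0 < size phi <= m.+1)%N -> (size phi <= size w)%N ->
  (occurrences phi w <= count (has_suffix phi) (edges_of r w)
    <= occurrences phi w + m)%N.
Proof.
case/andP=> phi0 phim phiw.
have a0 : Sigma by case: (phi) phi0.
pose e0 : E := [tuple of nseq m.+1 a0].
rewrite -[edges_of r w](mkseq_nth e0) /mkseq count_map size_edges_of.
(* The first [(size phi).-1] edges end too early for a copy of [phi] inside [w]; the others match
   the possible starting positions. *)
have -> : size w = ((size phi).-1 + (size w - size phi).+1)%N.
  by rewrite addnS -addSn prednK// subnKC.
rewrite iotaD count_cat add0n addnC.
have -> : count (preim (nth e0 (edges_of r w)) (has_suffix phi))
    (iota (size phi).-1 (size w - size phi).+1) = occurrences phi w.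
  rewrite occurrences_count -[X in iota X _]addn0 iotaDl count_map.
  apply: eq_in_count => i; rewrite mem_iota add0n ltnS /= => /= iw.
  rewrite /has_suffix nth_edges_of; last by lia.
  rewrite -{2}(subnKC phim) -take_drop drop_drop.
  have -> : (m.+1 - size phi + ((size phi).-1 + i))%N = (i + size r)%N.
    by rewrite size_tuple; lia.
  by rewrite -drop_drop drop_size_cat.
rewrite leq_addr leq_add2l (leq_trans (count_size _ _))// size_iota; lia.
Qed.

(** The theorem reads prefixes, while walks are counted by suffixes. Where the window fits into the
    source vertex, balance replaces the edges leaving that vertex by those entering it, in which the
    window sits one letter further right. *)
Lemma prefix_suffix_sum (R : nmodType) (x : E -> R) (phi : seq Sigma) :
  balanced esrc etgt x -> (size phi <= m.+1)%N ->
  \sum_(e : E | take (size phi) e == phi) x e = \sum_(e | has_suffix phi e) x e.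
Proof.
move=> xb phim.
pose S i := \sum_(e : E | take (size phi) (drop i e) == phi) x e.
have step i : (i < m.+1 - size phi)%N -> S i = S i.+1.
  move=> im; have im' : (size phi <= m - i)%N by lia.
  have take_src (e : E) :
      take (size phi) (drop i e) = take (size phi) (drop i (esrc e)).
    rewrite {1}val_src_last drop_rcons ?size_tuple; last by lia.
    by rewrite -cats1 takel_cat// size_drop size_tuple; lia.
  have -> : S i = \sum_(v : V | take (size phi) (drop i v) == phi)
                     \sum_(e | esrc e == v) x e.
    rewrite /S (partition_big esrc (fun v : V => take (size phi) (drop i v) == phi)).
      apply: eq_bigr => v vphi; apply: eq_bigl => e.
      case: (esrc e =P v) => [ev|]; rewrite ?andbF// andbT take_src ev.
      by rewrite vphi.
    by move=> e; rewrite take_src.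
  under eq_bigr do rewrite -xb.
  rewrite /S (partition_big etgt (fun v : V => take (size phi) (drop i v) == phi)).
    apply: eq_bigr => v vphi; apply: eq_bigl => e.
    case: (etgt e =P v) => [ev|]; rewrite ?andbF// andbT.
    by rewrite thead_behead /= [X in drop i X](congr1 val ev) vphi.
  by move=> e; rewrite thead_behead.
have S0 i : (i <= m.+1 - size phi)%N -> S 0%N = S i.
  elim: i => [_|i IH im]; first by [].
  exact: etrans (IH (ltnW im)) (step i im).
transitivity (S 0%N); first by apply: eq_bigl => e; rewrite drop0.
rewrite (S0 _ (leqnn _)); apply: eq_bigl => e.
rewrite /has_suffix take_oversize// size_drop size_tuple; lia.
Qed.

(** Appending one fixed letter leads from every vertex to the constant word, which provides the tree
    of last exits. *)
Lemma iter_ext (a : Sigma) (v : V) k : (k <= m)%N ->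
  tval (iter k (etgt \o ext^~ a) v) = drop k v ++ nseq k a.
Proof.
elim: k => [|k IH] km; first by rewrite drop0 cats0.
have -> : tval (iter k.+1 (etgt \o ext^~ a) v)
    = behead (rcons (tval (iter k (etgt \o ext^~ a) v)) a) by [].
rewrite (IH (ltnW km)) rcons_cat -[rcons _ _]/(rcons (nseq k a) a).
have -> : rcons (nseq k a) a = nseq k.+1 a.
  by elim: (k) => //= j ->.
rewrite -addn1 addnC -drop_drop drop1.
have := size_drop k v; rewrite size_tuple.
by case: (drop k v) => [|? ?] //= h; lia.
Qed.

End DeBruijn.

(** * Entropy of shift invariant measures *)

Section Measures.
Variables (R : realType) (Sigma : finType) (m : nat).
Local Notation V := (m.-tuple Sigma).
Local Notation E := (m.+1.-tuple Sigma).
Local Notation esrc := (@esrc Sigma m).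
Local Notation etgt := (@etgt Sigma m).

Lemma shift_invariantP (nu : E -> R) :
  shift_invariant_measures R Sigma m nu <->
  [/\ forall w, 0 <= nu w, \sum_w nu w = 1 & balanced esrc etgt nu].
Proof.
by split => -[h1 h2 h3]; split => // v; have := h3 v; rewrite sum_esrc sum_etgt.
Qed.

Lemma prefix_marginalE (F : {fset seq Sigma}) (nu : E -> R) (phi : F) :
  (size (val phi) <= m.+1)%N -> shift_invariant_measures R Sigma m nu ->
  prefix_marginal nu phi = \sum_(e | has_suffix (val phi) e) nu e.
Proof. by move=> phim /shift_invariantP [_ _ nub]; exact: prefix_suffix_sum. Qed.

(** The factor [ln 2] turns bits into nats, and the uniform mass contributes [ln #|Sigma|] because
    [nu] has total mass 1. *)
Lemma entropy_rate (nu : E -> R) : (0 < #|Sigma|)%N ->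
  shift_invariant_measures R Sigma m nu ->
  entropy esrc nu = ln 2 * (log2 #|Sigma|%:R - rate_function nu).
Proof.
move=> S0 /shift_invariantP [nu0 nu1 _].
have ln20 : ln 2 != 0 :> R by rewrite gt_eqF// ln_gt0// ltr1n.
rewrite mulrBr /log2 mulrC divfK// /rate_function /entropy.
have -> : \sum_v xlnx (\sum_(e | esrc e == v) nu e)
    = \sum_e nu e * ln (\sum_(f | esrc f == esrc e) nu f).
  rewrite [RHS](partition_big esrc xpredT)//=; apply: eq_bigr => v _.
  by rewrite /xlnx mulr_suml; apply: eq_bigr => e /eqP <-.
have lnS : ln #|Sigma|%:R = \sum_e nu e * ln #|Sigma|%:R :> R.
  by rewrite -mulr_suml nu1 mul1r.
rewrite [X in _ = X - _]lnS mulr_sumr -!sumrB.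
apply: eq_bigr => e _.
rewrite /first_marginal -/(esrc e) -(sum_esrc nu) /uniform_mass /log2.
have [->|ne] := eqVneq (nu e) 0; first by rewrite /xlnx !mul0r mulr0 subr0.
have ne0 : 0 < nu e by rewrite lt_neqAle eq_sym ne nu0.
have n1 : 0 < \sum_(f | esrc f == esrc e) nu f.
  by rewrite (bigD1 e)//= ltr_pwDl ?sumr_ge0.
have Sr : 0 < #|Sigma|%:R :> R by rewrite ltr0n.
rewrite ln_div ?posrE ?mulr_gt0 ?invr_gt0// lnM ?posrE ?invr_gt0// lnV ?posrE//.
by rewrite /xlnx; field.
Qed.

(** Compactness: measures of entropy above S + e with violations tending to 0 would accumulate at an
    admissible measure of entropy at least S + e. *)
Lemma admissible_limit_entropy (F : {fset seq Sigma}) (P : F -> R) (S : R) :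
  (forall mu, admissible_measures P m mu -> entropy esrc mu <= S) ->
  forall e, 0 < e -> exists2 d, 0 < d &
    forall nu, shift_invariant_measures R Sigma m nu ->
      (forall phi, prefix_marginal nu phi <= P phi + d) ->
      entropy esrc nu <= S + e.
Proof.
move=> entS e e0; apply: contrapT => nex.
have ex n : exists nu : E -> R, [/\ shift_invariant_measures R Sigma m nu,
    forall phi, prefix_marginal nu phi <= P phi + n.+1%:R^-1
    & S + e < entropy esrc nu].
  apply: contrapT => nnu; apply: nex; exists n.+1%:R^-1; first by rewrite invr_gt0.
  move=> nu nu1 nu2; rewrite leNgt; apply/negP => nu3; apply: nnu.
  by exists nu.
have [u uP] := boolp.choice ex.
have uS n : shift_invariant_measures R Sigma m (u n) by have [] := uP n.
have u0 n w : 0 <= u n w by have /shift_invariantP [] := uS n.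
have u1 n : \sum_w u n w = 1 by have /shift_invariantP [] := uS n.
(* Point masses lie in the cube [[0, 1]^E], compact by Tychonoff's theorem. *)
pose X : topologicalType := prod_topology (fun _ : E => R).
pose K := [set f : X | forall i, `[0%R, 1%R]%classic (f i)].
have Kcpt : @compact X K.
  have := @tychonoff E (fun _ => R) (fun _ => `[0%R, 1%R]%classic).
  by apply => i; exact: segment_compact.
have uK : ((u : nat -> X) @ \oo) K.
  exists 0%N => // n _ i /=; rewrite in_itv /= u0 -(u1 n) (bigD1 i)//= lerDl.
  by rewrite sumr_ge0.
have [p [_ pcl]] : exists p : X, (K `&` cluster ((u : nat -> X) @ \oo)) p := Kcpt _ _ uK.
have coord i : (f : X) i @[f --> p] --> p i.
  exact: (@proj_continuous _ (fun _ : E => R) i p).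
(* Weak inequalities pass to the cluster point even with a vanishing slack: otherwise the midpoint
   of [c] and [g p] would separate the sequence from [p]. *)
have limit (g : X -> R) (c : R) :
    (g f @[f --> p] --> g p) ->
    (forall n, g (u n) <= c + n.+1%:R^-1) -> g p <= c.
  move=> gp gu; rewrite leNgt; apply/negP => cg.
  have d0 : 0 < (g p - c) / 2 by rewrite divr_gt0// subr_gt0.
  have near_p : nbhs p
      [set f | (g p + c) / 2 < g f].
    by apply: (cvgr_gt _ gp); lra.
  have near_u : \forall n \near \oo, g (u n) <= (g p + c) / 2.
    near=> n; apply: le_trans (gu n) _.
    have : n.+1%:R^-1 < (g p - c) / 2.
      by near: n; exact: near_infty_natSinv_lt (PosNum d0).
    by move=> h; apply: le_trans (lerD (lexx c) (ltW h)) _; lra.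
  have [f [/= f1 f2]] := pcl [set f | g f <= (g p + c) / 2] _ near_u near_p.
  by move: (lt_le_trans f2 f1); rewrite ltxx.
have limit0 (g : X -> R) (c : R) :
    (g f @[f --> p] --> g p) ->
    (forall n, g (u n) <= c) -> g p <= c.
  by move=> gp gu; apply: limit => // n; rewrite (le_trans (gu n))// lerDl invr_ge0.
have cont (Q : pred E) :
    \sum_(i | Q i) (f : X) i @[f --> p] -->
    \sum_(i | Q i) p i.
  exact: (@cvg_sumr R X (nbhs p) (nbhs_filter p) _ _ Q (fun i (f : X) => f i) p
    (fun i _ => coord i)).
have p0 w : 0 <= p w.
  rewrite -oppr_le0; apply: (limit0 (fun f : X => - f w)); first exact: cvgN (coord w).
  by move=> n; rewrite oppr_le0.
have p1 : \sum_w p w = 1.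
  apply/eqP; rewrite eq_le (limit0 (fun f : X => \sum_w f w) 1)//=; last first.
    by move=> n; rewrite u1.
  rewrite -lerN2; apply: (limit0 (fun f : X => - \sum_w f w)); first exact: cvgN (cont xpredT).
  by move=> n; rewrite u1.
have pS : shift_invariant_measures R Sigma m p.
  apply/shift_invariantP; split => // v; apply/eqP; rewrite eq_le -subr_le0.
  rewrite (limit0 (fun f : X => \sum_(i | etgt i == v) f i - \sum_(i | esrc i == v) f i))/=.
  - rewrite -subr_le0.
    apply: (limit0 (fun f : X => \sum_(i | esrc i == v) f i - \sum_(i | etgt i == v) f i)).
      exact: cvgB (cont _) (cont _).
    by move=> n; have /shift_invariantP [_ _ ->] := uS n; rewrite subrr.
  - exact: cvgB (cont _) (cont _).
  - by move=> n; have /shift_invariantP [_ _ ->] := uS n; rewrite subrr.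
have padm : admissible_measures P m p.
  split => // phi; rewrite /prefix_marginal; split.
    rewrite sumr_ge0//= -p1 [X in _ <= X](bigID (fun w : E =>
      take (size (val phi)) w == val phi))/=.
    by rewrite lerDl sumr_ge0.
  apply: (limit (fun f : X => \sum_(w : E | take (size (val phi)) w == val phi) f w)).
    exact: (cont (fun w : E => take (size (val phi)) w == val phi)).
  by move=> n; have [_ + _] := uP n; exact.
have : - entropy esrc p <= - (S + e).
  apply: (limit0 (fun f : X => - entropy esrc f)).
    exact: cvgN (@cvg_entropy R V E esrc X (nbhs p) (nbhs_filter p) (fun f : X => f) p coord).
  by move=> n; rewrite lerN2 ltW//; have [] := uP n.
by have := entS p padm; lra.
Unshelve. all: end_near.
Qed.

End Measures.

(** * Upper bound *)

Section UpperBound.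
Variables (R : realType) (Sigma : finType) (m : nat).
Local Notation V := (m.-tuple Sigma).
Local Notation E := (m.+1.-tuple Sigma).
Local Notation esrc := (@esrc Sigma m).
Local Notation etgt := (@etgt Sigma m).

(** The tangent bound for [ln] is taken with slope [d], chosen so that [C * d <= e / 2]; the [+ 1]
    in [d] covers C = 0. *)
Lemma ln_negligible (C K e : R) (D : nat) : 0 <= C -> 0 < e ->
  \forall n \near \oo, C * ln (n + D)%N.+1%:R + K <= e * n%:R.
Proof.
move=> C0 e0; pose d := e / (2 * (C + 1)).
have C1 : 0 < C + 1 by lra.
have d0 : 0 < d by rewrite divr_gt0// mulr_gt0.
pose K' := C * (d * D.+1%:R - 1 - ln d) + K.
near=> n.
have z0 : 0 < (n + D)%N.+1%:R :> R by rewrite ltr0n.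
have lnz : ln (n + D)%N.+1%:R <= d * (n + D)%N.+1%:R - 1 - ln d.
  have := @le_ln1Dx R (d * (n + D)%N.+1%:R - 1).
  rewrite [1 + _]addrC subrK lnM ?posrE//.
  by have := mulr_gt0 d0 z0; lra.
apply: (@le_trans _ _ (C * (d * (n + D)%N.+1%:R - 1 - ln d) + K)).
  by rewrite lerD2r ler_wpM2l.
have -> : C * (d * (n + D)%N.+1%:R - 1 - ln d) + K = C * d * n%:R + K'.
  by rewrite /K' -addnS natrD; ring.
have Cd : C * d <= e / 2.
  have -> : e / 2 = (C + 1) * d by rewrite /d; field; rewrite gt_eqF.
  by rewrite ler_pM2r//; lra.
apply: (@le_trans _ _ (e / 2 * n%:R + K')).
  by rewrite lerD2r ler_wpM2r.
suff : K' <= e / 2 * n%:R by lra.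
rewrite mulrC -ler_pdivrMr ?divr_gt0//.
near: n; exact: nbhs_infty_ger.
Unshelve. all: end_near.
Qed.

Variables (F : {fset seq Sigma}) (P : F -> R) (xi : nat -> R).
Hypothesis P_ge0 : forall phi, 0 <= P phi.
Hypothesis xi_ge0 : forall n, 0 <= xi n.
Hypothesis F_size : forall phi : F, (0 < size (val phi) <= m.+1)%N.

(** Appending [r] brings the walk back to [r], so the counts are balanced. *)
Definition closed_walk_counts (r : V) (w : seq Sigma) (e : E) : nat :=
  count_mem e (edges_of r (w ++ r)).

(** At most [m] windows overlap the initial [r], and at most [m] more come from the appended one,
    whence the error (m + m) / n. *)
Lemma closed_walk_measure (r : V) n (w : n.-tuple Sigma) :
  (m < n)%N -> w \in weak_block P xi n ->
  let mu e : R := (n + m)%N%:R^-1 * (closed_walk_counts r w e)%:R in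
  shift_invariant_measures R Sigma m mu /\
  forall phi, prefix_marginal mu phi <= P phi + (xi n + (m + m)%N%:R / n%:R).
Proof.
move=> mn wB mu; have mu_def : mu = (fun e =>
  (n + m)%N%:R^-1 * (closed_walk_counts r w e)%:R) by [].
have L0 : 0 < (n + m)%N%:R :> R by rewrite ltr0n; lia.
have muS : shift_invariant_measures R Sigma m mu.
  apply/shift_invariantP; rewrite mu_def; split.
  - by move=> e; rewrite mulr_ge0 ?invr_ge0.
  - rewrite -mulr_sumr -natr_sum -(count_sum_mem xpredT) count_predT.
    by rewrite size_edges_of size_cat !size_tuple mulVf ?gt_eqF.
  - move=> v; rewrite -!mulr_sumr -!natr_sum; congr (_ * _%:R).
    have := walk_flow v (walk_edges_of r (w ++ r)).
    have -> : endpoint etgt r (edges_of r (w ++ r)) = r.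
      apply: val_inj; rewrite [LHS]val_endpoint catA drop_size_cat//.
      by rewrite !size_cat !size_tuple addnC.
    by move=> /addIn; rewrite !count_sum_mem.
split => // phi; have /andP [phi0 phim] := F_size phi.
rewrite prefix_marginalE// mu_def -mulr_sumr -natr_sum.
rewrite -(count_sum_mem (has_suffix (val phi))) edges_of_cat count_cat.
have phiw : (size (val phi) <= size w)%N by rewrite size_tuple; lia.
have /andP [_ h1] := count_has_suffix r (F_size phi) phiw.
set c2 := count _ _; set c3 := count _ _.
have h2 : (c3 <= m)%N by rewrite (leq_trans (count_size _ _))// size_edges_of size_tuple.
have : (c2 + c3 <= occurrences (val phi) w + (m + m))%N.
  by rewrite addnA; exact: leq_add h1 h2.
rewrite -(ler_nat R) [X in _ <= X]natrD => h.
have occ : (occurrences (val phi) w)%:R <= (n + m)%N%:R * (P phi + xi n) :> R.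
  move: wB; rewrite inE => /forallP/(_ phi); rewrite /frequency phiw.
  rewrite -/(occurrences (val phi) w) size_tuple => fw.
  rewrite ler_pdivrMr ?ltr0n// mulrC in fw; apply: le_trans fw _.
  rewrite ler_wpM2r ?addr_ge0// ler_nat (leq_trans _ (leq_addr _ _))//.
  by rewrite ltn_subrL phi0 (leq_ltn_trans _ mn).
rewrite mulrC ler_pdivrMr//; apply: le_trans h _.
apply: (@le_trans _ _ ((n + m)%N%:R * (P phi + xi n) + (m + m)%N%:R)).
  by rewrite lerD2r.
have n0 : 0 < n%:R :> R by rewrite ltr0n; lia.
suff : (m + m)%N%:R <= (m + m)%N%:R / n%:R * (n + m)%N%:R :> R.
  by move=> mm; rewrite addrA mulrDl [(P phi + xi n) * _]mulrC lerD2l.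
rewrite mulrAC ler_pdivlMr// ler_wpM2l// ler_nat; lia.
Qed.

(** The method of types: a word is classified by its edge counts, and the polynomial number of
    classes costs only o(n) in the exponent. *)
Lemma weak_block_upper (S : R) : (0 < #|Sigma|)%N ->
  xi n @[n --> \oo] --> 0 ->
  (forall mu, admissible_measures P m mu -> entropy esrc mu <= S) ->
  forall e, 0 < e -> \forall n \near \oo,
    (#|weak_block P xi n|)%:R <= expR (n%:R * (S + e)).
Proof.
move=> S0 xi0 entS e e0.
have e2 : 0 < e / 2 by lra.
have [d d0 entd] := admissible_limit_entropy entS e2.
have /card_gt0P [a0 _] := S0.
pose r : V := [tuple of nseq m a0].
have near_d : \forall n \near \oo, xi n + (m + m)%N%:R / n%:R <= d.
  have h : xi n + (m + m)%N%:R / n%:R @[n --> \oo] --> (0 + (m + m)%N%:R * 0 : R).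
    apply: cvgD xi0 _; apply: cvgM (cvg_cst _) _.
    apply/gtr0_cvgV0; last exact: cvgr_idn.
    by exists 1%N => // k /= k0; rewrite ltr0n.
  by rewrite mulr0 addr0 in h; exact: (cvgr_le _ h).
have near_ln := @ln_negligible #|{: E}|%:R (m%:R * (S + e / 2)) (e / 2) m
  (ler0n _ _) e2.
near=> n.
have dn : xi n + (m + m)%N%:R / n%:R <= d by near: n.
have mn : (m < n)%N by near: n; exact: nbhs_infty_gt.
pose L := (n + m)%N.
pose N (w : n.-tuple Sigma) := closed_walk_counts r w.
have L0 : 0 < L%:R :> R by rewrite ltr0n /L; lia.
have entN w : w \in weak_block P xi n ->
    entropy esrc (fun e => (N w e)%:R : R) <= L%:R * (S + e / 2).
  move=> wB; have [h1 h2] := closed_walk_measure r mn wB.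
  have h3 : entropy esrc (fun e => L%:R^-1 * (N w e)%:R : R) <= S + e / 2.
    by apply: entd => // phi; apply: le_trans (h2 phi) _; rewrite lerD2l.
  rewrite entropyM ?invr_gt0// in h3.
  by rewrite -ler_pdivrMl.
have sizeL (w : n.-tuple Sigma) : size (edges_of r (w ++ r)) == L.
  by rewrite size_edges_of size_cat !size_tuple.
(* Counts are at most [L], so [inord] is exact and there are (L + 1)^|E| classes. *)
pose tau (w : n.-tuple Sigma) : {ffun E -> 'I_L.+1} := [ffun e => inord (N w e)].
have tauE w e' : tau w e' = N w e' :> nat.
  rewrite ffunE inordK// ltnS -(eqP (sizeL w)); exact: count_size.
have fiber (t : {ffun E -> 'I_L.+1}) :
    (\sum_(w | (w \in weak_block P xi n) && (tau w == t)) 1)%N%:R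
      <= expR (L%:R * (S + e / 2)).
  case: (pickP (fun w => (w \in weak_block P xi n) && (tau w == t))); last first.
    by move=> none; rewrite big_pred0// expR_ge0.
  move=> w0 /andP [w0B /eqP w0t].
  apply: (@le_trans _ _ (expR (entropy esrc (fun e => (N w0 e)%:R : R)))); last first.
    by rewrite ler_expR entN.
  apply: le_trans _ (few_walks R esrc etgt (N w0) L r).
  rewrite ler_nat sum1_card.
  pose g (w : n.-tuple Sigma) : L.-tuple E := Tuple (sizeL w).
  have inj : injective g.
    move=> w1 w2 /(congr1 val) /= /(can_inj (edges_ofK r)) /eqP.
    by rewrite eqseq_cat ?size_tuple// => /andP [/eqP/val_inj].
  rewrite -(fintype.card_image inj); apply: subset_leq_card; apply/fintype.subsetP => p.
  case/fintype.imageP => w; rewrite inE => /andP [_ /eqP wt] ->.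
  apply/andP; split; first exact: walk_edges_of.
  apply/forallP => e'.
  by rewrite -(tauE w0) w0t -wt tauE.
have : (#|weak_block P xi n|)%:R <= L.+1%:R ^+ #|{: E}| * expR (L%:R * (S + e / 2)).
  rewrite -sum1_card (partition_big tau xpredT)//= natr_sum.
  apply: le_trans (ler_sum _ (fun t _ => fiber t)) _.
  by rewrite sumr_const card_ffun card_ord -[X in X <= _]mulr_natl natrX.
move=> /le_trans; apply.
rewrite -[L.+1%:R]lnK ?posrE ?ltr0n// -expRM_natl -expRD ler_expR.
rewrite /L natrD.
have : #|{: E}|%:R * ln (n + m)%N.+1%:R + m%:R * (S + e / 2) <= e / 2 * n%:R :> R.
  by near: n.
lra.
Unshelve. all: end_near.
Qed.

End UpperBound.

(** * Lower bound *)

Section LowerBound.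
Variables (R : realType) (Sigma : finType) (m : nat).
Local Notation V := (m.-tuple Sigma).
Local Notation E := (m.+1.-tuple Sigma).
Local Notation esrc := (@esrc Sigma m).
Local Notation etgt := (@etgt Sigma m).
Local Notation elast := (@elast Sigma m).
Variables (F : {fset seq Sigma}) (P : F -> R) (xi : nat -> R).
Hypothesis P_ge0 : forall phi, 0 <= P phi.
Hypothesis F_size : forall phi : F, (0 < size (val phi) <= m.+1)%N.
Hypothesis Sigma_gt1 : (1 < #|Sigma|)%N.
Hypothesis xi_large : forall n : nat, (0 < n)%N ->
  2 * #|Sigma|%:R ^+ m * n%:R^-1 <= xi n.

Lemma card_has_suffix (phi : seq Sigma) : (size phi <= m.+1)%N ->
  (#|[pred e : E | has_suffix phi e]| <= #|Sigma| ^ (m.+1 - size phi))%N.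
Proof.
move=> phim; rewrite -card_tuple.
have sz (e : E) : size (take (m.+1 - size phi) e) == (m.+1 - size phi)%N.
  by rewrite size_takel// size_tuple leq_subr.
pose g e : (m.+1 - size phi).-tuple Sigma := Tuple (sz e).
have inj : {in [pred e : E | has_suffix phi e] &, injective g}.
  move=> e1 e2; rewrite !inE => /eqP h1 /eqP h2 /(congr1 val)/= h.
  apply: val_inj; rewrite -[LHS](cat_take_drop (m.+1 - size phi)).
  by rewrite -[RHS](cat_take_drop (m.+1 - size phi)) h h1 h2.
by rewrite -(fintype.card_in_image inj) max_card.
Qed.

(** For a word of length j the excess is at most 2 on each of at most |Sigma|^(m+1-j) edges; it is
    to be covered by [xi n] times the n - j + 1 positions. *)
Lemma weak_block_of_counts (mu : E -> R) (r : V) n (w : n.-tuple Sigma) :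
  admissible_measures P m mu -> (m < n)%N -> (m.*2 <= n)%N ->
  (forall e, (count_mem e (edges_of r w))%:R <= (n - m)%N%:R * mu e + 2) ->
  w \in weak_block P xi n.
Proof.
move=> [muS muP] mn m2n cnt; rewrite inE; apply/forallP => phi.
have /andP [phi0 phim] := F_size phi.
have phiw : (size (val phi) <= size w)%N by rewrite size_tuple; exact: leq_trans phim mn.
rewrite /frequency phiw -/(occurrences (val phi) w) size_tuple.
set j := size (val phi) in phi0 phim phiw *.
have /andP [occ _] := count_has_suffix r (F_size phi) phiw.
rewrite ler_pdivrMr ?ltr0n//.
have n0 : (0 < n)%N by exact: leq_ltn_trans mn.
apply: (@le_trans _ _ ((n - m)%N%:R * P phi + 2 * (#|Sigma| ^ (m.+1 - j))%N%:R)).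
  apply: (@le_trans _ _ (\sum_(e : E | has_suffix (val phi) e) ((n - m)%N%:R * mu e + 2))).
    move: occ; rewrite count_sum_mem -(ler_nat R) natr_sum => /le_trans; apply.
    by apply: ler_sum => e _.
  rewrite big_split /= -mulr_sumr -(prefix_marginalE phim muS) sumr_const.
  rewrite lerD//.
    by rewrite ler_wpM2l//; have [] := muP phi.
  rewrite -[_ *+ _]mulr_natr ler_wpM2l// ler_nat; exact: card_has_suffix.
rewrite [X in _ <= X]mulrDl; have := xi_large n0 => xin.
(* Using the scale n - m and not n keeps the main term below [P phi] times the number of
   positions. *)
have jn : (n - m <= (n - j).+1)%N by lia.
rewrite [X in _ <= X + _]mulrC; apply: lerD; first by rewrite ler_wpM2r ?ler_nat.
apply: (@le_trans _ _ (2 * #|Sigma|%:R ^+ m / n%:R * (n - j).+1%:R)); last first.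
  by rewrite ler_wpM2r.
have -> : 2 * #|Sigma|%:R ^+ m / n%:R * (n - j).+1%:R
    = 2 * (#|Sigma|%:R ^+ m * (n - j).+1%:R / n%:R) :> R by ring.
rewrite ler_pM2l// ler_pdivlMr ?ltr0n//.
rewrite -natrX -!natrM ler_nat.
(* For j = 1 there are exactly n positions. For larger j there are at least n / 2, and the spare
   factor |Sigma| >= 2 makes up for it. *)
have [j1|j1] := leqP j 1.
  have -> : j = 1%N by lia.
  by rewrite subn1 /= subn1 prednK.
have -> : (m = m.-1.+1)%N by lia.
rewrite expnS.
have le1 : (#|Sigma| ^ (m.-1.+2 - j) <= #|Sigma| ^ m.-1)%N.
  by rewrite leq_pexp2l//; lia.
have le2 : (2 * #|Sigma| ^ m.-1 <= #|Sigma| * #|Sigma| ^ m.-1)%N.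
  by rewrite leq_mul2r Sigma_gt1 orbT.
have le3 : (n <= (n - j).+1 * 2)%N by lia.
apply: leq_trans (leq_mul le1 le3) _.
by rewrite mulnA [X in (X <= _)%N]mulnC mulnA leq_mul2r le2 orbT.
Qed.

(* The all-ones circulation is added to the rounded one to make it connected, so
   each edge count may exceed its target by 2: this is the slack that [xi_large]
   provides. *)
Lemma weak_block_ge (mu : E -> R) (b0 : Sigma) (N : E -> nat) n :
  admissible_measures P m mu -> (m < n)%N -> (m.*2 <= n)%N ->
  (forall v, (\sum_(e | etgt e == v) N e = \sum_(e | esrc e == v) N e)%N) ->
  (forall e, (n - m)%N%:R * mu e - 1 <= (N e)%:R <= (n - m)%N%:R * mu e + 1) ->
  (n - m)%N%:R <= (\sum_e N e)%N%:R :> R ->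
  expR (entropy esrc (fun e => ((N e).+1 - (e == ext (esrc e) b0))%N%:R)
     - #|{: V}|%:R * (#|{: E}|%:R * (ln (n + #|{: E}| * 2)%N.+1%:R + 1)))
  <= #|weak_block P xi n|%:R * #|Sigma|%:R ^+ (#|{: E}| * 2) :> R.
Proof.
move=> muA mn m2n Nbal Nmu Nsum.
pose M e := (N e).+1; pose L := (\sum_e M e)%N.
pose r : V := [tuple of nseq m b0].
have muS := muA.1; have [mu0 mu1 _] := muS.
have LE : L = (\sum_e N e + #|{: E}|)%N.
  rewrite /L /M -sum1_card -big_split /=.
  by apply: eq_bigr => e _; rewrite addn1.
(* The all-ones circulation contributes |E| >= m edges, which makes up for the scale n - m. *)
have nL : (n <= L)%N.
  rewrite LE -(subnK (ltnW mn)) leq_add//; first by rewrite -(ler_nat R).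
  by rewrite card_tuple (leq_trans _ (ltnW (ltn_expl _ Sigma_gt1))).
(* Each edge gains at most 1 from rounding and 1 from the all-ones circulation. *)
have Ln : (L <= n + #|{: E}| * 2)%N.
  rewrite LE muln2 -addnn addnA leq_add2r -(ler_nat R) natr_sum.
  apply: (@le_trans _ _ (\sum_e ((n - m)%N%:R * mu e + 1))).
    by apply: ler_sum => e _; have /andP [] := Nmu e.
  rewrite big_split /= -mulr_sumr mu1 mulr1 sumr_const natrD lerD2r ler_nat.
  exact: leq_subr.
have Mbal v : (\sum_(e | etgt e == v) M e = \sum_(e | esrc e == v) M e)%N.
  have add1 (Q : pred E) : (\sum_(e | Q e) M e = \sum_(e | Q e) N e + \sum_(e | Q e) 1)%N.
    by rewrite -big_split /=; apply: eq_bigr => e _; rewrite addn1.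
  rewrite !add1 Nbal; congr addn.
  by rewrite [LHS](sum_etgt (fun=> 1%N)) [RHS](sum_esrc (fun=> 1%N)).
have root v : exists k, iter k (etgt \o (fun v => ext v b0)) v = r.
  exists m; apply: val_inj; rewrite [LHS]iter_ext//.
  by rewrite drop_oversize ?size_tuple.
have := many_circuits R (fun v => esrc_ext v b0) root Mbal (fun=> ltn0Sn _) (erefl L).
set A := #|[pred p : L.-tuple E | walk esrc etgt r p && with_counts M p]|.
set x := entropy _ _; move=> lowA.
(* Cut the word of the circuit after [n] letters: the first part lies in the block, the rest is one
   of |Sigma|^(L-n) words. *)
have leA : (A <= #|weak_block P xi n| * #|Sigma| ^ (L - n))%N.
  rewrite -card_tuple -cardsT -cardsX.
  have s1 (p : L.-tuple E) : size (take n (map elast p)) == n.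
    by rewrite size_takel// size_map size_tuple.
  have s2 (p : L.-tuple E) : size (drop n (map elast p)) == (L - n)%N.
    by rewrite size_drop size_map size_tuple.
  pose g (p : L.-tuple E) := (Tuple (s1 p), Tuple (s2 p)).
  have inj : {in [pred p : L.-tuple E | walk esrc etgt r p && with_counts M p] &,
      injective g}.
    move=> p1 p2; rewrite !inE => /andP [/walk_edgesE w1 _] /andP [/walk_edgesE w2 _].
    move=> [h1 h2]; apply: val_inj; rewrite /= w1 w2; congr edges_of.
    by rewrite -(cat_take_drop n (map elast p1)) h1 h2 cat_take_drop.
  rewrite /A -(card_in_imset inj); apply: subset_leq_card.
  apply/fintype.subsetP => _ /imsetP [p /andP [/walk_edgesE pw /forallP pM] ->].
  rewrite !inE andbT; have := @weak_block_of_counts mu r n (Tuple (s1 p)) muA mn m2n.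
  rewrite inE; apply => e.
  apply: (@le_trans _ _ (M e)%:R); last first.
    by rewrite /M -natr1; have /andP [_ h] := Nmu e; lra.
  rewrite ler_nat -(eqP (pM e)) [in leqRHS]pw.
  by rewrite -[in leqRHS](cat_take_drop n (map elast p)) edges_of_cat count_cat leq_addr.
apply: le_trans (_ : A%:R <= _).
  apply: le_trans lowA; rewrite ler_expR lerD2l lerN2.
  rewrite !ler_wpM2l// lerD2r ler_ln ?posrE ?ltr0n// ler_nat ltnS; exact: Ln.
rewrite -natrX -natrM ler_nat; apply: leq_trans leA _.
rewrite leq_mul2l leq_pexp2l ?orbT//; first exact: ltnW.
by rewrite leq_subLR.
Qed.

Lemma weak_block_lower (mu : E -> R) : admissible_measures P m mu ->
  forall e, 0 < e -> \forall n \near \oo,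
    expR (n%:R * (entropy esrc mu - e)) <= #|weak_block P xi n|%:R.
Proof.
move=> muA e e0; have muS := muA.1; have /shift_invariantP [mu0 mu1 mub] := muS.
have /card_gt0P [b0 _] : (0 < #|Sigma|)%N by exact: ltnW.
have ex n := @rounding V E esrc etgt R (fun e => (n - m)%N%:R * mu e)
  (fun e => mulr_ge0 (ler0n _ _) (mu0 e))
  (fun v => etrans (esym (mulr_sumr _ _ _ _)) (etrans (congr1 _ (mub v)) (mulr_sumr _ _ _ _))).
have [N NP] := boolp.choice ex.
pose M n (e : E) : R := ((N n e).+1 - (e == ext (esrc e) b0))%N%:R.
(* The error stays bounded in [n]: [m] comes from the scale, the rest from rounding, the added ones
   and the reserved tree edges. *)
have Mmu n e' : `|M n e' - n%:R * mu e'| <= m%:R + 3.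
  have [_ /(_ e')/andP [N1 N2] _] := NP n.
  have M1 : (N n e')%:R <= M n e' by rewrite ler_nat; case: eqP => _ /=; lia.
  have M2 : M n e' <= (N n e')%:R + 1 by rewrite natr1 ler_nat; exact: leq_subr.
  have mu_le1 : mu e' <= 1 by rewrite -mu1 (bigD1 e')//= lerDl sumr_ge0.
  have n1 : n%:R - m%:R <= (n - m)%N%:R :> R.
    by rewrite lerBlDr -natrD ler_nat; lia.
  have n2 : (n - m)%N%:R <= n%:R :> R by rewrite ler_nat leq_subr.
  have h1 : (n%:R - m%:R) * mu e' <= (n - m)%N%:R * mu e' by rewrite ler_wpM2r.
  have h2 : (n - m)%N%:R * mu e' <= n%:R * mu e' by rewrite ler_wpM2r.
  have h3 : m%:R * mu e' <= m%:R :> R by rewrite ler_piMr.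
  have m0 : 0 <= m%:R :> R by [].
  by rewrite ler_norml; apply/andP; split; lra.
have cvgM e' : n%:R^-1 * M n e' @[n --> \oo] --> mu e'.
  apply/cvgrPdist_le => d d0; near=> n.
  have n0 : 0 < n%:R :> R by rewrite ltr0n; near: n; exact: nbhs_infty_gt.
  have -> : mu e' - n%:R^-1 * M n e' = - ((M n e' - n%:R * mu e') / n%:R).
    by field; rewrite gt_eqF.
  rewrite normrN normrM normfV (ger0_norm (ltW n0)) ler_pdivrMr//.
  apply: le_trans (Mmu n e') _; rewrite mulrC -ler_pdivrMr//.
  by near: n; exact: nbhs_infty_ger.
(* By homogeneity and continuity the entropy of [M n] is n times that of [mu], up to o(n). *)
have cvgS := @cvg_entropy R V E esrc _ _ eventually_filter _ _ cvgM.
have e2 : 0 < e / 2 by lra.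
have lt_ent : entropy esrc mu - e / 2 < entropy esrc mu by lra.
have near_ent := @cvgr_ge _ _ _ eventually_filter _ _ cvgS _ lt_ent.
pose C : R := #|{: V}|%:R * #|{: E}|%:R; pose D := (#|{: E}| * 2)%N.
have C0 : 0 <= C by rewrite mulr_ge0.
have near_ln := ln_negligible (C + D%:R * ln #|Sigma|%:R) D C0 e2.
near=> n.
have n0 : (0 < n)%N by near: n; exact: nbhs_infty_gt.
have mn : (m < n)%N by near: n; exact: nbhs_infty_gt.
have m2n : (m.*2 <= n)%N by near: n; exact: nbhs_infty_ge.
have ent : entropy esrc mu - e / 2 <= entropy esrc (fun e => n%:R^-1 * M n e).
  by near: n.
have lnn : C * ln (n + D)%N.+1%:R + (C + D%:R * ln #|Sigma|%:R) <= e / 2 * n%:R.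
  by near: n.
have [N1 N2 N3] := NP n.
have Nsum : (n - m)%N%:R <= (\sum_e N n e)%N%:R :> R.
  by rewrite -mulr_sumr mu1 mulr1 in N3.
have := weak_block_ge b0 muA mn m2n N1 N2 Nsum.
have sig0 : 0 < #|Sigma|%:R :> R by rewrite ltr0n ltnW.
rewrite -[#|Sigma|%:R in X in _ <= X]lnK ?posrE// -expRM_natl -/D -ler_pdivrMr ?expR_gt0//.
rewrite -expRN -expRD; apply: le_trans; rewrite ler_expR.
rewrite entropyM ?invr_gt0 ?ltr0n// in ent.
have nR : 0 < n%:R :> R by rewrite ltr0n.
have entM : n%:R * (entropy esrc mu - e / 2) <= entropy esrc (fun e' : E =>
    ((N n e').+1 - (e' == ext (esrc e') b0))%N%:R).
  by rewrite -ler_pdivlMl.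
rewrite mulrA -/C; lra.
Unshelve. all: end_near.
Qed.

End LowerBound.

(** * Degenerate cases: the empty word and one-letter alphabets *)

Lemma reduced_sizes (Sigma : finType) (F : {fset seq Sigma}) (m : nat) :
  reduced F -> max_length F = m.+1 ->
  (0 < #|Sigma|)%N /\ forall phi : F, (0 < size (val phi) <= m.+1)%N.
Proof.
move=> Fred kmax.
have F0 : (0 < #|{: F}|)%N.
  rewrite lt0n; apply/negP => /eqP/card0_eq F0.
  by move: kmax; rewrite /max_length big_pred0.
pose FT : finType := fset_sub_type F.
have [phi0] := @bigop.eq_bigmax FT (fun phi => size (val phi)) F0.
rewrite -/(max_length F) kmax => phi0E; split.
  by case: (val phi0) phi0E => // a s _; apply/card_gt0P; exists a.
move=> phi; rewrite -kmax (@bigop.leq_bigmax FT (fun phi => size (val phi)) phi) andbT.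
(* The empty word is a proper subword of the longest word [phi0], so reducedness excludes it. *)
rewrite lt0n size_eq0; apply/negP => /eqP phi_nil.
have : [::] \notin F.
  apply: (Fred (val phi0)); [exact: fsvalP|exact: infix0s|].
  by apply/eqP => nil0; rewrite -nil0 in phi0E.
by rewrite -phi_nil => /negP; apply; exact: fsvalP.
Qed.

Section Unary.
Variables (R : realType) (Sigma : finType) (m : nat).
Local Notation V := (m.-tuple Sigma).
Local Notation E := (m.+1.-tuple Sigma).
Local Notation esrc := (@esrc Sigma m).
Hypothesis Sigma1 : #|Sigma| = 1%N.

Lemma unary_eq (a b : Sigma) : a = b.
Proof. by apply: (fintype_le1P _); rewrite Sigma1. Qed.

(** Every vertex has a single exit, so the two sums agree term by term. *)
Lemma unary_entropy (mu : E -> R) : entropy esrc mu = 0.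
Proof.
have /card_gt0P [a0 _] : (0 < #|Sigma|)%N by rewrite Sigma1.
have sum1 (f : Sigma -> R) : \sum_a f a = f a0.
  by apply: big_pred1 => a; rewrite /= (unary_eq a a0) eqxx.
rewrite /entropy [X in _ - X](partition_big esrc xpredT)//= -sumrB big1// => v _.
by rewrite !sum_esrc !sum1 subrr.
Qed.

(** All of the mass sits on a constant word, so feasibility forces [P phi] to be at least 1, and the
    constant word of length [n] meets every constraint. *)
Lemma unary_weak_block (F : {fset seq Sigma}) (P : F -> R) (xi : nat -> R)
    (mu : E -> R) n :
  (forall phi : F, (size (val phi) <= m.+1)%N) -> (forall n, 0 <= xi n) ->
  admissible_measures P m mu -> (0 < #|weak_block P xi n|)%N.
Proof.
move=> phim xi0 [[mu0 mu1 _] muP].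
have /card_gt0P [a0 _] : (0 < #|Sigma|)%N by rewrite Sigma1.
apply/card_gt0P; exists [tuple of nseq n a0]; rewrite inE; apply/forallP => phi.
have P1 : 1 <= P phi.
  have [_] := muP phi; apply: le_trans; rewrite -mu1 /prefix_marginal.
  rewrite [X in X <= _](bigID (fun w : E => take (size (val phi)) w == val phi))/=.
  rewrite [X in _ + X]big_pred0 ?addr0// => w; apply/negbF/eqP.
  apply: (@eq_from_nth _ a0) => [|i _]; last exact: unary_eq.
  by rewrite size_takel// size_tuple; exact: phim.
apply: (@le_trans _ _ 1); last by rewrite (le_trans P1)// lerDl.
rewrite /frequency; case: ifP => // _.
by rewrite ler_pdivrMr ?ltr0n// mul1r ler_nat -[leqRHS]card_ord max_card.
Qed.

End Unary.

(** * Convergence of the rates *)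

Section Main.
Variables (R : realType) (Sigma : finType) (m : nat).
Local Notation E := (m.+1.-tuple Sigma).
Local Notation esrc := (@esrc Sigma m).

(** A crude bound that makes the infimum of the rates finite: the vertex terms are nonpositive, and
    - t ln t <= 1 - t. *)
Lemma entropy_le (mu : E -> R) : shift_invariant_measures R Sigma m mu ->
  entropy esrc mu <= #|{: E}|%:R.
Proof.
move=> [mu0 mu1 _]; have sum_le1 (Q : pred E) : \sum_(e | Q e) mu e <= 1.
  by rewrite -mu1 [X in _ <= X](bigID Q)/= lerDl sumr_ge0.
rewrite /entropy -sumrN -[X in _ <= X]add0r; apply: lerD.
  apply: sumr_le0 => v _; rewrite /xlnx mulr_ge0_le0 ?sumr_ge0//.
  exact/ln_le0/sum_le1.
have -> : #|{: E}|%:R = \sum_(e : E) 1 :> R by rewrite sumr_const.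
apply: ler_sum => e _; rewrite /xlnx.
have [->|e0] := eqVneq (mu e) 0; first by rewrite mul0r oppr0 ler01.
have {}e0 : 0 < mu e by rewrite lt_neqAle eq_sym e0 mu0.
have := ler_ln_sub e0 ltr01; rewrite ln1 sub0r => h.
have : mu e * - ln (mu e) <= mu e * ((1 - mu e) / mu e) by rewrite ler_pM2l.
by rewrite mulrCA divff ?gt_eqF//; lra.
Qed.

End Main.

Theorem theorem21 (R : realType) (Sigma : finType) (F : {fset seq Sigma})
    (P : F -> R) (xi : nat -> R) (m : nat)
    (F_reduced : reduced F)
    (P01 : forall phi : F, 0 <= P phi <= 1)
    (xi_tol : tolerance xi)
    (* k = m.+1 *)
    (k_max : max_length F = m.+1)
    (feasible : admissible_measures P m !=set0)
    (xi_large : forall n : nat, (0 < n)%N ->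
       2 * #|Sigma|%:R ^+ m * n%:R^-1 <= xi n) :
  let value : \bar R :=
    ((log2 (#|Sigma|%:R : R))%:E
     - ereal_inf [set (rate_function mu)%:E | mu in admissible_measures P m])%E
  in
  weak_cap P xi = value /\ weak_rate P xi n @[n --> \oo] --> value.
Proof.
move=> value.
have [Sigma0 F_size] := reduced_sizes F_reduced k_max.
have [xi_gt0 xi_o _] := xi_tol.
have xi_ge0 n : 0 <= xi n by exact/ltW/xi_gt0.
have P_ge0 phi : 0 <= P phi by have /andP [] := P01 phi.
have xi0 : xi n @[n --> \oo] --> 0.
  apply/cvgrPdist_le => e e0; have /eqoP/(_ e e0) := xi_o.
  by apply: filterS => n; rewrite sub0r normrN normr1 mulr1.
have ln2 : 0 < ln 2 :> R by rewrite ln_gt0// ltr1n.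
pose rates : set R := [set rate_function mu | mu in admissible_measures P m].
have rates0 : rates !=set0.
  by have [mu muA] := feasible; exists (rate_function mu), mu.
have entE mu : admissible_measures P m mu ->
    entropy (@esrc Sigma m) mu = ln 2 * (log2 #|Sigma|%:R - rate_function mu).
  by case=> muS _; exact: entropy_rate.
have rates_lb : has_lbound rates.
  exists (log2 #|Sigma|%:R - #|{: m.+1.-tuple Sigma}|%:R / ln 2).
  move=> _ [mu muA <-]; have := entropy_le muA.1; rewrite entE//.
  rewrite mulrC -ler_pdivlMr//; lra.
have valueE : value = (log2 #|Sigma|%:R - inf rates)%:E.
  rewrite /value EFinB -ereal_inf_EFin//; congr (_ - ereal_inf _)%E.
  by rewrite -image_comp.
set v := log2 #|Sigma|%:R - inf rates in valueE.
have ent_le mu : admissible_measures P m mu ->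
    entropy (@esrc Sigma m) mu <= ln 2 * v.
  move=> muA; rewrite entE// ler_pM2l// lerD2l lerN2.
  by apply: ge_inf => //; exists mu.
have upper := weak_block_upper P_ge0 xi_ge0 F_size Sigma0 xi0 ent_le.
have lower e : 0 < e -> \forall n \near \oo,
    expR (n%:R * (ln 2 * v - e)) <= #|weak_block P xi n|%:R.
  move=> e0; have e2 : 0 < e / 2 by lra.
  (* Rates are in bits and entropies in nats, hence the division by [ln 2]. *)
  have [_ [mu muA <-] mu_lt] := inf_adherent (divr_gt0 e2 ln2) (conj rates0 rates_lb).
  have ent_ge : ln 2 * v - e / 2 <= entropy (@esrc Sigma m) mu.
    move: mu_lt; rewrite -ltrBlDl ltr_pdivlMr// entE// /v; lra.
  have main : \forall n \near \oo,
      expR (n%:R * (entropy (@esrc Sigma m) mu - e / 2)) <= #|weak_block P xi n|%:R.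
    (* The comparison with the tolerance uses two letters; a one-letter alphabet is treated
       apart. *)
    have [Sigma_gt1|Sigma_le1] := ltnP 1 #|Sigma|.
      exact: weak_block_lower.
    have Sigma1 : #|Sigma| = 1%N by apply/eqP; rewrite eqn_leq Sigma_le1.
    apply: nearW => n; rewrite unary_entropy// sub0r.
    apply: (@le_trans _ _ 1); first by rewrite expR_le1 mulrN oppr_le0 mulr_ge0// ltW.
    have F_le (phi : F) : (size (val phi) <= m.+1)%N by have /andP [] := F_size phi.
    by rewrite ler1n; exact: (unary_weak_block Sigma1 n F_le xi_ge0 muA).
  apply: filterS main => n; apply: le_trans; rewrite ler_expR ler_wpM2l//; lra.
suff rate_cvg : weak_rate P xi n @[n --> \oo] --> value.
  by split => //; rewrite /weak_cap; have [_ ->] := cvg_limn_einf_sup rate_cvg.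
(* [elog2 0] is -oo, so the real logarithm takes over only once the blocks are nonempty. *)
have near_pos : \forall n \near \oo, (0 < #|weak_block P xi n|)%N.
  apply: filterS (lower 1 ltr01) => n h; rewrite -(ltr0n R).
  exact: lt_le_trans (expR_gt0 _) h.
have near_eq : \forall n \near \oo,
    (n%:R^-1 * (ln #|weak_block P xi n|%:R / ln 2))%:E = weak_rate P xi n.
  apply: filterS near_pos => n n0.
  by rewrite /weak_rate /elog2 lne_EFin ?ltr0n// -EFinM.
rewrite valueE; apply: cvg_trans (near_eq_cvg near_eq) _.
apply: cvg_EFin; first by apply: nearW.
apply/cvgrPdist_le => e e0.
have d0 : 0 < e * ln 2 by rewrite mulr_gt0.
have lower_e := lower _ d0; have upper_e := upper _ d0.
near=> n.
have B0 : 0 < #|weak_block P xi n|%:R :> R by rewrite ltr0n; near: n.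
have n0 : 0 < n%:R :> R by rewrite ltr0n; near: n; exact: nbhs_infty_gt.
have h1 : n%:R * (ln 2 * v - e * ln 2) <= ln #|weak_block P xi n|%:R.
  by rewrite -ler_expR lnK ?posrE//; near: n.
have h2 : ln #|weak_block P xi n|%:R <= n%:R * (ln 2 * v + e * ln 2).
  by rewrite -ler_expR lnK ?posrE//; near: n.
rewrite distrC ler_distl /=.
have -> : n%:R^-1 * (ln #|weak_block P xi n|%:R / ln 2)
   = ln #|weak_block P xi n|%:R / (n%:R * ln 2) :> R.
  by field; rewrite !gt_eqF.
have nl : 0 < n%:R * ln 2 :> R by rewrite mulr_gt0.
rewrite ler_pdivlMr// ler_pdivrMr//; apply/andP; split; lra.
Unshelve. all: end_near.
Qed.
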